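(* Let $u_1,\dots,u_4$ be a positive orthonormal basis of an oriented Euclidean four-space $\mathcal{T}$. Given $\mathrm{s},\lambda,\xi,c_2,c_3,c_4\in\mathbb{R}$ with $c_2+c_3+c_4=0$ and $\lambda>0$, let $R$ be the algebraic curvature tensor in $\mathcal{T}$ with scalar curvature $\mathrm{s}$, with Einstein tensor $\mathrm{e}$ diagonalized by $u_1,u_2,u_3,u_4$ with the respective eigenvalues $(\mu_1,\mu_2,\mu_3,\mu_4)=(-\lambda,-\lambda,\lambda,\lambda)$, and such that, for each sign $\pm$, $W^\pm:\Lambda^\pm\to\Lambda^\pm$ is diagonalized by the basis $u_1\wedge u_2\pm u_3\wedge u_4,\ u_1\wedge u_3\pm u_4\wedge u_2,\ u_1\wedge u_4\pm u_2\wedge u_3$ of $\Lambda^\pm$ with the respective eigenvalues $\pm c_2-\mathrm{s}/12,\ \pm c_3+\xi-\mathrm{s}/12,\ \pm c_4-\xi+\mathrm{s}/6$. Then: (a) $R$ is weakly Einstein. (b) The only possibly-nonzero components of $W$ in the frame $u_1,\dots,u_4$ are those algebraically related to the ones in the ordered triples $(W_{1212},W_{1313},W_{1414})=(W_{3434},W_{2424},W_{2323})=(-\mathrm{s}/12,\ \xi-\mathrm{s}/12,\ -\xi+\mathrm{s}/6)$ and $(W_{1234},W_{1342},W_{1423})=(c_2,c_3,c_4)$. (c) For every weakly Einstein algebraic curvature tensor in an oriented Euclidean four-space such that $\mathrm{e}$ has two distinct double eigenvalues, there exist a positive orthonormal basis $u_1,\dots,u_4$ of the four-space and $\mathrm{s},\lambda,\xi,c_2,c_3,c_4\in\mathbb{R}$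 with $c_2+c_3+c_4=0$ and $\lambda>0$ such that its scalar curvature is $\mathrm{s}$, its Einstein tensor $\mathrm{e}$ is diagonalized by $u_1,u_2,u_3,u_4$ with the respective eigenvalues $-\lambda,-\lambda,\lambda,\lambda$ and, for each sign $\pm$, its $W^\pm:\Lambda^\pm\to\Lambda^\pm$ is diagonalized by the basis $u_1\wedge u_2\pm u_3\wedge u_4,\ u_1\wedge u_3\pm u_4\wedge u_2,\ u_1\wedge u_4\pm u_2\wedge u_3$ of $\Lambda^\pm$ with the respective eigenvalues $\pm c_2-\mathrm{s}/12,\ \pm c_3+\xi-\mathrm{s}/12,\ \pm c_4-\xi+\mathrm{s}/6$.
   Context: $\mathcal{T}$ is an oriented Euclidean four-space with inner product $\mathrm{g}$. An algebraic curvature tensor $R$ in $\mathcal{T}$ is a $(0,4)$ tensor with $R_{ijkl}=-R_{jikl}=-R_{ijlk}=R_{klij}$ and $R_{ijkl}+R_{jkil}+R_{kijl}=0$. In an orthonormal basis, the Ricci tensor is $\mathrm{r}_{ij}=\sum_k R_{ikjk}$, the scalar curvature is $\mathrm{s}=\sum_i \mathrm{r}_{ii}$, the Einstein (traceless Ricci) tensor is $\mathrm{e}=\mathrm{r}-\mathrm{s}\,\mathrm{g}/4$, and the Weyl component is $W_{ijkl}=R_{ijkl}-\frac12(\mathrm{g}_{ik}\mathrm{r}_{jl}+\mathrm{g}_{jl}\mathrm{r}_{ik}-\mathrm{g}_{il}\mathrm{r}_{jk}-\mathrm{g}_{jk}\mathrm{r}_{il})+\frac{\mathrm{s}}6(\mathrm{g}_{ik}\mathrm{g}_{jl}-\mathrm{g}_{il}\mathrm{g}_{jk})$.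 $R$ is called weakly Einstein if the symmetric tensor with components $\sum_{k,p,q}R_{ikpq}R_{jkpq}$ (in an orthonormal basis) is a multiple of $\mathrm{g}$. Eigenvalues of $\mathrm{e}$ are taken relative to $\mathrm{g}$; a double eigenvalue is one of multiplicity two. $\Lambda^\pm\subset\mathcal{T}^{\wedge2}$ are the three-dimensional spaces of self-dual and anti-self-dual bivectors; $W$ acts on bivectors $b$ by $[Wb]_{ij}=\sum_{p,q}W_{ipjq}b_{pq}=\frac12\sum_{p,q}W_{ijpq}b_{pq}$, this action preserves $\Lambda^\pm$, and $W^\pm:\Lambda^\pm\to\Lambda^\pm$ denote its restrictions. By the Singer-Thorpe theorem, prescribing $\mathrm{s}\in\mathbb{R}$, a $\mathrm{g}$-traceless symmetric tensor $\mathrm{e}$ and traceless self-adjoint $W^\pm:\Lambda^\pm\to\Lambda^\pm$ defines a unique algebraic curvature tensor $R$. Components of $W$ ''algebraically related'' to given ones are those obtained from them via the symmetries $W_{ijkl}=-W_{jikl}=-W_{ijlk}=W_{klij}$. *)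

(* Defs.v *)
From HB Require Import structures.
From mathcomp Require Import all_boot all_order all_algebra.
From mathcomp Require Import all_classical all_reals.

Set Implicit Arguments.
Unset Strict Implicit.
Unset Printing Implicit Defensive.

Import Order.TTheory GRing.Theory Num.Theory.
Local Open Scope classical_set_scope.
Local Open Scope ring_scope.

Definition same_orientation (R : realType) (V : vectType R)
    (o u : 4.-tuple V) : Prop :=
  basis_of {:V} u /\ 0 < \det (\matrix_(i < 4, j < 4) coord o j u`_i).

(* An orientation is a whole equivalence class of ordered bases. *)
Record oriented_euclidean4 (R : realType) := OrientedEuclidean4 {
  carrier :> vectType R;
  metric : {dot carrier for idfun};
  orientation : set (4.-tuple carrier);
  carrier_dim : \dim {:carrier} = 4%N;
  orientation_class :
    exists2 o : 4.-tuple carrier, basis_of {:carrier} o & orientation = [set u | same_orientation o u]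
}.

Section Tensors.
Variables (R : realType) (T : oriented_euclidean4 R).
Implicit Types (u : 4.-tuple T) (x y z t : T).

Local Notation g := (metric T).

Definition positive_onb u : Prop := orthonormal g u /\ orientation u.

(* A fixed positive orthonormal basis, used to write contractions and the
   volume form; the lemmas [contraction_onb] and [volume_onb] below show that
   neither depends on which one is chosen. *)
Definition onb : 4.-tuple T := xget [tuple 0 | _ < 4] [set u | positive_onb u].

Local Notation e i := onb`_(nat_of_ord i).

Definition curvature_tensor (Rm : T -> T -> T -> T -> R) : Prop :=
  [/\ [/\ forall y z t, scalar (fun x => Rm x y z t),
          forall x z t, scalar (fun y => Rm x y z t),
          forall x y t, scalar (fun z => Rm x y z t) &
          forall x y z, scalar (fun t => Rm x y z t)],
      forall x y z t, Rm x y z t = - Rm y x z t,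
      forall x y z t, Rm x y z t = - Rm x y t z,
      forall x y z t, Rm x y z t = Rm z t x y &
      forall x y z t, Rm x y z t + Rm y z x t + Rm z x y t = 0].

Section Components.
Variable Rm : T -> T -> T -> T -> R.

Definition ricci x y : R := \sum_(k < 4) Rm x (e k) y (e k).

Definition scalar_curvature : R := \sum_(i < 4) ricci (e i) (e i).

Definition einstein x y : R := ricci x y - scalar_curvature * g x y / 4.

Definition weyl x y z t : R :=
  Rm x y z t
  - 2^-1 * (g x z * ricci y t + g y t * ricci x z
            - g x t * ricci y z - g y z * ricci x t)
  + scalar_curvature / 6 * (g x z * g y t - g x t * g y z).

Definition weakly_einstein : Prop :=
  exists a : R, forall x y,
    \sum_(k < 4) \sum_(p < 4) \sum_(q < 4)
      Rm x (e k) (e p) (e q) * Rm y (e k) (e p) (e q) = a * g x y.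

End Components.

Definition diagonalized_form (b : T -> T -> R) u (mu : 4.-tuple R) : Prop :=
  forall (i : 'I_4) y, b u`_i y = mu`_i * g u`_i y.

Definition eigenvalue_of_multiplicity (b : T -> T -> R) (a : R) (n : nat) : Prop :=
  exists2 U : {vspace T},
    (forall x, x \in U <-> forall y, b x y = a * g x y) & \dim U = n.

Definition two_distinct_double_eigenvalues (b : T -> T -> R) : Prop :=
  exists a a' : R, [/\ a <> a', eigenvalue_of_multiplicity b a 2 &
                       eigenvalue_of_multiplicity b a' 2].

(* Bivectors are identified, through the metric, with skew-symmetric bilinear
   forms, so that b x y has b_pq as its components in an orthonormal basis. *)
Local Notation form2 := (T -> T -> R^o).

Definition bivector : set form2 :=
  [set b | [/\ forall y, scalar (b^~ y), forall x, scalar (b x) &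
               forall x y, b x y = - b y x]].

Definition wedge (v w : T) : form2 := fun x y => g v x * g w y - g v y * g w x.

Definition volume x y z t : R :=
  \det (\matrix_(i < 4, j < 4) g (e i) [:: x; y; z; t]`_j).

Definition hodge (b : form2) : form2 := fun x y =>
  2^-1 * \sum_(p < 4) \sum_(q < 4) volume x y (e p) (e q) * b (e p) (e q).

(* sg = false for the self-dual bivectors, sg = true for the anti-self-dual. *)
Definition Lambda (sg : bool) : set form2 :=
  [set b | bivector b /\ hodge b = (-1) ^+ sg *: b].

Definition Lambda_frame u (sg : bool) : 3.-tuple form2 :=
  [tuple wedge u`_0 u`_1 + (-1) ^+ sg *: wedge u`_2 u`_3;
         wedge u`_0 u`_2 + (-1) ^+ sg *: wedge u`_3 u`_1;
         wedge u`_0 u`_3 + (-1) ^+ sg *: wedge u`_1 u`_2].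

Definition weyl_action (Rm : T -> T -> T -> T -> R) (b : form2) : form2 :=
  fun x y => \sum_(p < 4) \sum_(q < 4) weyl Rm x (e p) y (e q) * b (e p) (e q).

Definition basis_of_forms n (S : set form2) (b : n.-tuple form2) : Prop :=
  (forall i, S (tnth b i)) /\
  forall w, S w -> exists! a : {ffun 'I_n -> R}, w = \sum_(i < n) a i *: tnth b i.

Definition diagonalized_by n (S : set form2) (A : form2 -> form2)
    (b : n.-tuple form2) (c : n.-tuple R) : Prop :=
  basis_of_forms S b /\ forall i, A (tnth b i) = tnth c i *: tnth b i.

(* The data prescribed by the Singer-Thorpe theorem; the frame vectors
   u_1, ..., u_4 are u`_0, ..., u`_3. *)
Definition curvature_data (Rm : T -> T -> T -> T -> R) u
    (s lambda xi c2 c3 c4 : R) : Prop :=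
  [/\ scalar_curvature Rm = s,
      diagonalized_form (einstein Rm) u
        [tuple - lambda; - lambda; lambda; lambda] &
      forall sg : bool,
        diagonalized_by (Lambda sg) (weyl_action Rm) (Lambda_frame u sg)
          [tuple (-1) ^+ sg * c2 - s / 12;
                 (-1) ^+ sg * c3 + xi - s / 12;
                 (-1) ^+ sg * c4 - xi + s / 6]].

End Tensors.

(* [algebraically_related i j k l p q r m]: the component with indices p q r m
   is obtained from the one with indices i j k l via the symmetries. *)
Inductive algebraically_related (i j k l : nat) : nat -> nat -> nat -> nat -> Prop :=
| related_refl : algebraically_related i j k l i j k l
| related_swapl p q r m : algebraically_related i j k l p q r m ->
    algebraically_related i j k l q p r m
| related_swapr p q r m : algebraically_related i j k l p q r m ->
    algebraically_related i j k l p q m r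
| related_pairs p q r m : algebraically_related i j k l p q r m ->
    algebraically_related i j k l r m p q.

Section OrthonormalBases.
Variables (R : realType) (T : oriented_euclidean4 R).
Implicit Types (u v : 4.-tuple T) (x y z t : T).
Local Notation g := (metric T).
Local Notation e i := (onb T)`_(nat_of_ord i).

Lemma metricC x y : g x y = g y x.
Proof. by rewrite hermC expr0 mul1r. Qed.

Lemma metricZr a x y : g x (a *: y) = a * g x y.
Proof. by rewrite linearZr_LR. Qed.

Lemma metricZl a x y : g (a *: x) y = a * g x y.
Proof. by rewrite linearZl_LR. Qed.

Lemma metric_sumr (I : finType) (F : I -> T) x : g x (\sum_i F i) = \sum_i g x (F i).
Proof. by rewrite linear_sumr. Qed.

Lemma metric_suml (I : finType) (F : I -> T) x : g (\sum_i F i) x = \sum_i g (F i) x.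
Proof. by rewrite linear_sumlz. Qed.

Definition gram_id n (u : 'I_n -> T) := forall i j, g (u i) (u j) = (i == j)%:R.

Lemma orthonormal_gram u : orthonormal g u <-> gram_id (fun i : 'I_4 => u`_i).
Proof.
case: u => -[|a [|b [|c [|d [|]]]]] //= sz; rewrite /orthonormal /=.
split.
  rewrite !andbT -!andbA; do 9!case/andP=> /eqP ?; move=> /eqP ? i j.
  by case: i => [[|[|[|[|?]]]] ?] //; case: j => [[|[|[|[|?]]]] ?] //;
    rewrite eqE //= metricC.
move=> h.
have {}h k l : (k < 4)%N -> (l < 4)%N ->
    g [:: a; b; c; d]`_k [:: a; b; c; d]`_l = (k == l)%:R.
  by move=> k4 l4; exact: (h (Ordinal k4) (Ordinal l4)).
have := (h 0 0, h 0 1, h 0 2, h 0 3, h 1 1, h 1 2, h 1 3, h 2 2, h 2 3, h 3 3)%N.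
by rewrite /= => -[[[[[[[[[-> // -> //] -> //] -> //] -> //] -> //] -> //] -> //]
  -> //] -> //]; rewrite !eqxx.
Qed.

Lemma gram_free n (u : 'I_n -> T) : gram_id u -> free (mktuple u).
Proof.
move=> gu; apply/freeP => k k0 i; have := congr1 (g (u i)) k0.
rewrite linear0r metric_sumr (bigD1 i) // big1 => [|j ij].
  by rewrite [X in X = 0 -> _]addr0 metricZr nth_mktuple /= gu eqxx mulr1.
by rewrite metricZr nth_mktuple /= gu eq_sym (negbTE ij) mulr0.
Qed.

Lemma gram_basis (u : 'I_4 -> T) : gram_id u -> basis_of {:T} (mktuple u).
Proof.
by move=> gu; rewrite basisEfree gram_free // subvf carrier_dim size_tuple.
Qed.

Lemma gram_expand (u : 'I_4 -> T) x : gram_id u -> x = \sum_i g (u i) x *: u i.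
Proof.
move=> gu; have xE := coord_basis (gram_basis gu) (memvf x).
rewrite {1}xE; apply: eq_bigr => i _; rewrite nth_mktuple; congr (_ *: _).
rewrite {2}xE metric_sumr (bigD1 i) // big1 => [|j ij].
  by rewrite [RHS]addr0 metricZr nth_mktuple /= gu eqxx mulr1.
by rewrite metricZr nth_mktuple /= gu eq_sym (negbTE ij) mulr0.
Qed.

Lemma gram_extend n (u : 'I_n -> T) : (n < 4)%N -> gram_id u ->
  exists u' : 'I_n.+1 -> T, gram_id u'.
Proof.
move=> n4 gu.
have [v vu] : exists v : T, v \notin <<mktuple u>>%VS.
  apply: contrapT => /forallNP h.
  have : ({:T} <= <<mktuple u>>)%VS by apply/subvP=> v _; apply/negPn/negP/h.
  move/dimvS; rewrite carrier_dim (eqP (gram_free gu)) size_tuple.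
  by rewrite leqNgt n4.
pose w := v - \sum_i g (u i) v *: u i.
have w0 : w != 0.
  apply: contra vu; rewrite subr_eq0 => /eqP->; apply: rpred_sum => i _.
  by apply/rpredZ/memv_span; apply/tnthP; exists i; rewrite tnth_mktuple.
have uw i : g (u i) w = 0.
  rewrite linearBr /= metric_sumr (bigD1 i) //= big1 => [|j ij].
    by rewrite metricZr /= gu eqxx mulr1 addr0 subrr.
  by rewrite metricZr /= gu eq_sym (negbTE ij) mulr0.
have gw : 0 < g w w by apply: neq0_dnorm_gt0.
pose w' := (Num.sqrt (g w w))^-1 *: w.
have gw' : g w' w' = 1.
  rewrite metricZr metricZl /= mulrA -invfM -expr2 sqr_sqrtr ?ltW //.
  by rewrite mulVf // gt_eqF.
have uw' i : g (u i) w' = 0 by rewrite metricZr /= uw mulr0.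
exists (fun i => if unlift ord0 i is Some j then u j else w') => i j.
case: unliftP => [i'|] ->; case: unliftP => [j'|] ->.
- by rewrite gu (inj_eq lift_inj).
- by rewrite uw' eq_sym (negbTE (neq_lift _ _)).
- by rewrite metricC uw' (negbTE (neq_lift _ _)).
- by rewrite gw' eqxx.
Qed.

Lemma gram_exists : exists u : 'I_4 -> T, gram_id u.
Proof.
have h0 : exists u : 'I_0 -> T, gram_id u by exists (fun _ => 0) => -[].
have [u1 /gram_extend[]// u2 /gram_extend[]// u3 /gram_extend[]//] := h0.
by move=> u4 /gram_extend[]// u5; exists u5.
Qed.

Lemma onbP : positive_onb (onb T).
Proof.
suff [u pu] : exists u, positive_onb u by exact: (@xgetPex _ _ [set u | positive_onb u] (ex_intro _ u pu)).
have [o bo oE] := orientation_class T.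
have [u gu] := gram_exists.
pose M (w : 'I_4 -> T) := \matrix_(i < 4, j < 4) coord o j (w i).
have pos (w : 'I_4 -> T) : gram_id w -> 0 < \det (M w) -> exists v, positive_onb v.
  move=> gw dw; exists (mktuple w); split.
    by apply/orthonormal_gram => i j; rewrite -!tnth_nth !tnth_mktuple.
  rewrite oE /=; split; first exact: gram_basis.
  rewrite (_ : (\matrix_(_, _) _) = M w) //; apply/matrixP => i j.
  by rewrite !mxE -tnth_nth tnth_mktuple.
have [|du|] := ltgtP 0 (\det (M u)); first exact: pos.
  pose d := \row_(i < 4) (if i == ord0 then -1 else 1 : R).
  apply: (pos (fun i => d 0 i *: u i)).
    move=> i j; rewrite metricZr metricZl /= gu !mxE.
    case: (eqVneq i j) => [->|]; last by rewrite !mulr0.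
    by case: ifP => _; rewrite !mulr1 ?mul1r // mulrNN mulr1.
  rewrite (_ : M _ = diag_mx d *m M u).
    rewrite det_mulmx det_diag big_ord_recl big1 => [|i _].
      by rewrite mxE eqxx mulr1 mulN1r oppr_gt0.
    by rewrite mxE.
  by apply/matrixP => i j; rewrite mul_diag_mx !mxE linearZ.
move=> /esym/eqP/det0P[a a0 aM]; case/eqP: a0.
apply/rowP => i; rewrite mxE.
have s0 : \sum_j a 0 j *: u j = 0.
  rewrite (coord_basis bo (memvf (\sum_j a 0 j *: u j))) big1 // => j _.
  rewrite linear_sum /=; have /rowP/(_ j) := aM; rewrite !mxE => sj.
  rewrite (eq_bigr (fun k => a 0 k * M u k j)) ?sj ?scale0r // => k _.
  by rewrite linearZ mxE.
have := congr1 (g (u i)) s0; rewrite linear0r metric_sumr (bigD1 i) //=.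
rewrite big1 ?addr0 => [|j ij]; first by rewrite metricZr /= gu eqxx mulr1.
by rewrite metricZr /= gu eq_sym (negbTE ij) mulr0.
Qed.

Definition transition u v := \matrix_(i < 4, k < 4) g u`_k v`_i.

Lemma transition_orth u v : orthonormal g u -> orthonormal g v ->
  (transition u v)^T *m transition u v = 1%:M.
Proof.
move=> /orthonormal_gram gu /orthonormal_gram gv.
apply/mulmx1C/matrixP => i j; rewrite !mxE -gv.
rewrite {1}(gram_expand v`_j gu) metric_sumr; apply: eq_bigr => k _.
by rewrite metricZr !mxE /= mulrC [g v`_i _]metricC.
Qed.

Lemma scalar_sum (f : T -> R) n (a : 'I_n -> R) (v : 'I_n -> T) : scalar f ->
  f (\sum_i a i *: v i) = \sum_i a i * f (v i).
Proof.
move=> fl; pose F : {scalar T} := HB.pack f (GRing.isLinear.Build _ _ _ _ f fl).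
suff : F (\sum_i a i *: v i) = \sum_i a i * F (v i) by [].
by rewrite linear_sum; apply: eq_bigr => i _; rewrite linearZ.
Qed.

(* The g-trace of a bilinear form may be computed in any orthonormal basis. *)
Lemma contraction_onb (b : T -> T -> R) u :
  (forall y, scalar (b^~ y)) -> (forall x, scalar (b x)) -> orthonormal g u ->
  \sum_(k < 4) b (e k) (e k) = \sum_(k < 4) b u`_k u`_k.
Proof.
move=> bl br ou; have [oe _] := onbP.
have QQ := transition_orth ou oe; set Q := transition _ _ in QQ.
have bE k : b (e k) (e k) = \sum_i \sum_j Q k i * Q k j * b u`_i u`_j.
  move/orthonormal_gram: ou => gu.
  rewrite {1}(gram_expand (e k) gu) (scalar_sum _ _ (bl (e k))).
  apply: eq_bigr => i _.
  rewrite {2}(gram_expand (e k) gu) (scalar_sum _ _ (br u`_i)) mulr_sumr.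
  by apply: eq_bigr => j _; rewrite !mxE mulrA.
under eq_bigr do rewrite bE.
rewrite exchange_big /=; apply: eq_bigr => i _.
rewrite exchange_big /= (bigD1 i) //= [X in _ + X]big1 => [|j ij].
  rewrite [LHS]addr0 -mulr_suml; have /matrixP/(_ i i) := QQ.
  rewrite !mxE eqxx (eq_bigr (fun k => Q k i * Q k i)) => [->|k _]; first by rewrite mul1r.
  by rewrite [_^T _ _]mxE.
rewrite -mulr_suml; have /matrixP/(_ i j) := QQ.
rewrite !mxE eq_sym (negbTE ij) (eq_bigr (fun k => Q k i * Q k j)) => [->|k _].
  by rewrite mul0r.
by rewrite [_^T _ _]mxE.
Qed.

Lemma det_transition u v : positive_onb u -> positive_onb v ->
  \det (transition u v) = 1.
Proof.
move=> [ou pu] [ov pv]; have [o bo oE] := orientation_class T.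
move: pu pv; rewrite oE /= => -[_ du] [_ dv].
have QQ := transition_orth ou ov.
have : \det (transition u v) ^+ 2 = 1.
  by rewrite expr2 -[X in X * _]det_tr -det_mulmx QQ det1.
move/eqP; rewrite sqrf_eq1 => /orP[/eqP//|/eqP dN].
move: dv; rewrite (_ : (\matrix_(_, _) _) =
   transition u v *m \matrix_(i < 4, j < 4) coord o j u`_i).
  by rewrite det_mulmx dN mulN1r oppr_gt0 ltNge ltW.
move/orthonormal_gram: ou => gu.
apply/matrixP => i j; rewrite !mxE {1}(gram_expand v`_i gu) linear_sum /=.
by apply: eq_bigr => k _; rewrite linearZ !mxE.
Qed.

Lemma volume_onb u x y z t : positive_onb u ->
  volume x y z t = \det (\matrix_(i < 4, j < 4) g u`_i [:: x; y; z; t]`_j).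
Proof.
move=> pu; have [oe pe] := onbP.
rewrite /volume -[RHS]mul1r -(det_transition pu onbP) -det_mulmx.
congr (\det _); apply/matrixP => i j; rewrite !mxE.
have [/orthonormal_gram gu _] := pu.
rewrite [in LHS](gram_expand (e i) gu) metric_suml; apply: eq_bigr => k _.
by rewrite metricZl !mxE.
Qed.
End OrthonormalBases.

(* Main.v *)
Require Import Defs.
From HB Require Import structures.
From mathcomp Require Import all_boot all_order all_algebra.
From mathcomp Require Import all_classical all_reals.
From mathcomp Require Import ring lra.

Set Implicit Arguments.
Unset Strict Implicit.
Unset Printing Implicit Defensive.

Import Order.TTheory GRing.Theory Num.Theory.
Local Open Scope ring_scope.

(** The curvature operator on bivectors is studied in the basis of the six frame
    bivectors, grouped into the dual pairs (12, 34), (13, 42), (14, 23).  The sum and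
    the difference of a dual pair are a self-dual and an anti-self-dual bivector, so
    an operator with these sums and differences as eigenvectors is one that splits
    into three symmetric 2 x 2 blocks with equal diagonal entries, and conversely
    ([dual_block_eigen]).  For the Weyl tensor with the prescribed eigenvalues the
    blocks have the diagonal entries [-s/12, xi - s/12, -xi + s/6] and the
    off-diagonal entries [c2, c3, c4]; this is part (b).  Adding the Einstein and
    scalar parts keeps the blocks and turns the diagonal entries into [-lambda] and
    [lambda] for the first pair, into [xi] twice for the second one, and into
    [s/4 - xi] twice for the third ([curvature_data_blocks]).

    Part (a) follows since the quadratic contraction of the curvature is twice the sum
    of the contracted squares of the images of the six frame bivectors.  Dual bivectors
    have complementary planes, so that a block whose diagonal entries have
    equal squares contributes a multiple of the metric ([blocks_square]).

    For part (c), orthonormal bases of the two eigenplanes of the Einstein tensor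
    give a frame with Einstein eigenvalues [-lambda, -lambda, lambda, lambda], unique
    up to rotations of the two planes (and reflections).  Rotating both planes by
    the same angle rotates the last two vectors of the self-dual frame and fixes the
    anti-self-dual one; opposite angles do the converse.  Hence the rotations can be
    chosen so that the entry of both [W+] and [W-] at the last two frame bivectors
    vanishes ([unmixed_eigenframe]).  A reflection of the last vector, which preserves
    all this, makes the frame positive ([orthonormal_orientation]).  In this frame the
    equations for the Ricci tensor are linear in the curvature components, and
    modulo them the weakly Einstein condition becomes linear, too: it says that
    [lambda] times certain components vanishes, or has the required value
    ([block_equations]).  As [lambda] is nonzero, the blocks are those above
    ([eigenframe_blocks]), and the Bianchi identity gives [c2 + c3 + c4 = 0]. *)

(** * Bilinear forms and bivectors in an orthonormal frame *)

Section Forms.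
Variables (R : realType) (T : oriented_euclidean4 R).
Implicit Types (u v : 4.-tuple T) (x y z t : T).
Local Notation g := (metric T).
Local Notation e i := (onb T)`_(nat_of_ord i).
Local Notation form2 := (T -> T -> R^o).

Lemma metric_scalarr x : scalar (g x).
Proof. by move=> a y z; rewrite linearPr. Qed.

Lemma metric_scalarl y : scalar (g^~ y).
Proof. by move=> a x z; rewrite linearPl. Qed.

Lemma scalar0 (f : T -> R) : scalar f -> f 0 = 0.
Proof. by move=> fl; have := fl (-1) 0 0; rewrite scaler0 addr0 mulN1r addNr. Qed.

Lemma scalarZ (f : T -> R) a x : scalar f -> f (a *: x) = a * f x.
Proof. by move=> fl; have := fl a x 0; rewrite !addr0 (scalar0 fl) addr0. Qed.

Lemma scalarN (f : T -> R) x : scalar f -> f (- x) = - f x.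
Proof. by move=> fl; rewrite -scaleN1r (scalarZ _ _ fl) mulN1r. Qed.

Lemma scalar_comb (f : T -> R) a b x y : scalar f ->
  f (a *: x + b *: y) = a * f x + b * f y.
Proof. by move=> fl; rewrite fl (scalarZ _ _ fl). Qed.

Definition bilinear_form (b : T -> T -> R) :=
  (forall y, scalar (b^~ y)) /\ (forall x, scalar (b x)).

Section Frame.
Variable u : 4.-tuple T.
Hypothesis ou : orthonormal g u.

Lemma frame_gram i j : (i < 4)%N -> (j < 4)%N -> g u`_i u`_j = (i == j)%:R.
Proof.
by move=> i4 j4; apply: ((orthonormal_gram u).1 ou (Ordinal i4) (Ordinal j4)).
Qed.

Definition frame_gramE :=
  (frame_gram (isT : 0 < 4) (isT : 0 < 4), frame_gram (isT : 0 < 4) (isT : 1 < 4),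
   frame_gram (isT : 0 < 4) (isT : 2 < 4), frame_gram (isT : 0 < 4) (isT : 3 < 4),
   frame_gram (isT : 1 < 4) (isT : 0 < 4), frame_gram (isT : 1 < 4) (isT : 1 < 4),
   frame_gram (isT : 1 < 4) (isT : 2 < 4), frame_gram (isT : 1 < 4) (isT : 3 < 4),
   frame_gram (isT : 2 < 4) (isT : 0 < 4), frame_gram (isT : 2 < 4) (isT : 1 < 4),
   frame_gram (isT : 2 < 4) (isT : 2 < 4), frame_gram (isT : 2 < 4) (isT : 3 < 4),
   frame_gram (isT : 3 < 4) (isT : 0 < 4), frame_gram (isT : 3 < 4) (isT : 1 < 4),
   frame_gram (isT : 3 < 4) (isT : 2 < 4), frame_gram (isT : 3 < 4) (isT : 3 < 4))%N.

Lemma frame_expand (f : T -> R) x : scalar f ->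
  f x = g u`_0 x * f u`_0 + g u`_1 x * f u`_1
        + g u`_2 x * f u`_2 + g u`_3 x * f u`_3.
Proof.
move=> fl; rewrite {1}(gram_expand x ((orthonormal_gram u).1 ou)).
by rewrite scalar_sum // !big_ord_recl big_ord0 /= addr0 !addrA.
Qed.

Lemma frame_parseval (f : T -> R) x : scalar f ->
  \sum_(q < 4) f u`_q * g x u`_q = f x.
Proof.
move=> fl; rewrite {2}(gram_expand x ((orthonormal_gram u).1 ou)).
by rewrite scalar_sum //; apply: eq_bigr => q _; rewrite mulrC metricC.
Qed.

(** With the frame vectors numbered from 1, as in all comments, the six terms are
    grouped in the dual pairs (12, 34), (13, 42), (14, 23):
    the two indices of one bivector complement those of the other, and the order
    of the last two makes each pair positively oriented.  Every later sum over
    pairs of frame indices uses this ordering. *)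
Lemma bivector_expand (b : form2) x y : bivector b ->
  b x y = b u`_0 u`_1 * wedge u`_0 u`_1 x y + b u`_2 u`_3 * wedge u`_2 u`_3 x y
        + (b u`_0 u`_2 * wedge u`_0 u`_2 x y + b u`_3 u`_1 * wedge u`_3 u`_1 x y)
        + (b u`_0 u`_3 * wedge u`_0 u`_3 x y + b u`_1 u`_2 * wedge u`_1 u`_2 x y).
Proof.
move=> [bl br ba].
have b0 z : b z z = 0.
  (* Forms take values in R^o; the cast exposes the ring R to the decision
     procedures. *)
  by have h : (b z z : R) = - (b z z : R) := ba z z; apply: (_ : (_ : R) = 0); lra.
rewrite (frame_expand x (bl y)) (frame_expand y (br u`_0)).
rewrite (frame_expand y (br u`_1)) (frame_expand y (br u`_2)).
rewrite (frame_expand y (br u`_3)) !b0 (ba u`_1 u`_0) (ba u`_2 u`_0).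
rewrite (ba u`_3 u`_0) (ba u`_2 u`_1) (ba u`_1 u`_3) (ba u`_3 u`_2) /wedge.
by ring.
Qed.

End Frame.

(** Up to a constant factor, both the Hodge star and the Weyl action have this shape
    in [b], with [F] the volume form, respectively the Weyl tensor, at two fixed
    arguments. *)
Definition pairing (F b : T -> T -> R) : R :=
  \sum_(p < 4) \sum_(q < 4) F (e p) (e q) * b (e p) (e q).

Lemma pairingD F (b b' : form2) : pairing F (b + b') = pairing F b + pairing F b'.
Proof.
rewrite /pairing -big_split; apply: eq_bigr => p _; rewrite -big_split.
by apply: eq_bigr => q _; exact: mulrDr.
Qed.

Lemma pairingZ F a (b : form2) : pairing F (a *: b) = a * pairing F b.
Proof.
rewrite /pairing mulr_sumr; apply: eq_bigr => p _; rewrite mulr_sumr.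
by apply: eq_bigr => q _; exact: mulrCA.
Qed.

(** Contracting with [g x] and [g y] in any orthonormal basis substitutes [x] and
    [y].  This is what removes the arbitrary reference basis from the
    definitions. *)
Lemma pairing_wedge F x y : bilinear_form F ->
  pairing F (wedge x y) = F x y - F y x.
Proof.
move=> [Fl Fr]; have [oe _] := onbP T.
have half z t :
    \sum_(p < 4) \sum_(q < 4) F (e p) (e q) * (g z (e p) * g t (e q)) = F z t.
  rewrite -[RHS](frame_parseval oe _ (Fl t)); apply: eq_bigr => p _.
  rewrite -(frame_parseval oe _ (Fr (e p))) mulr_suml.
  by apply: eq_bigr => q _; rewrite mulrA mulrAC.
rewrite -{1}half -half -sumrB; apply: eq_bigr => p _.
by rewrite -sumrB; apply: eq_bigr => q _; rewrite /wedge; ring.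
Qed.

End Forms.

(** * Symmetries of the Ricci and Weyl tensors *)

Section Curvature.
Variables (R : realType) (T : oriented_euclidean4 R).
Implicit Types (u : 4.-tuple T) (x y z t : T).
Local Notation g := (metric T).
Local Notation form2 := (T -> T -> R^o).
Variable Rm : T -> T -> T -> T -> R.
Hypothesis cRm : curvature_tensor Rm.

Lemma curvature_bivectorl z t : bivector ((fun x y => Rm x y z t) : form2).
Proof. by have [[l1 l2 _ _] a _ _ _] := cRm; split=> // x y; rewrite a. Qed.

Lemma curvature_bivectorr x y : bivector (Rm x y : form2).
Proof. by have [[_ _ l3 l4] _ a _ _] := cRm; split=> // z t; rewrite a. Qed.

Lemma ricciC x y : ricci Rm x y = ricci Rm y x.
Proof. by have [_ _ _ s _] := cRm; apply: eq_bigr => k _; rewrite s. Qed.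

Lemma ricci_scalarr x : scalar (ricci Rm x).
Proof.
have [[_ _ l _] _ _ _ _] := cRm => a y z; rewrite /ricci mulr_sumr -big_split.
by apply: eq_bigr => k _; rewrite l.
Qed.

Lemma ricci_scalarl y : scalar ((ricci Rm)^~ y).
Proof. by move=> a x z; rewrite ricciC ricci_scalarr !(ricciC y). Qed.

Lemma ricci_onb u x y : orthonormal g u ->
  ricci Rm x y = \sum_(k < 4) Rm x u`_k y u`_k.
Proof.
have [[_ l2 _ l4] _ _ _ _] := cRm => ou.
exact: (@contraction_onb _ _ (fun z t => Rm x z y t)).
Qed.

Lemma scalar_curvature_onb u : orthonormal g u ->
  scalar_curvature Rm = \sum_(i < 4) ricci Rm u`_i u`_i.
Proof. exact: contraction_onb ricci_scalarl ricci_scalarr. Qed.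

Lemma einsteinC x y : einstein Rm x y = einstein Rm y x.
Proof. by rewrite /einstein ricciC metricC. Qed.

Lemma einstein_scalarl y : scalar ((einstein Rm)^~ y).
Proof.
by move=> a x z; rewrite /einstein ricci_scalarl metric_scalarl; ring.
Qed.

Lemma ricciE x y : ricci Rm x y = einstein Rm x y + scalar_curvature Rm / 4 * g x y.
Proof. by rewrite /einstein; ring. Qed.

Lemma weyl_bivectorl z t : bivector ((fun x y => weyl Rm x y z t) : form2).
Proof.
have [[l1 l2 _ _] a _ _ _] := cRm.
split=> [y b x x'|x b y y'|x y].
- by rewrite /weyl l1 ricci_scalarl ricci_scalarl !metric_scalarl; ring.
- by rewrite /weyl l2 ricci_scalarl ricci_scalarl !metric_scalarl; ring.
- by rewrite /weyl a; ring.
Qed.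

Lemma weylC x y z t : weyl Rm x y z t = weyl Rm z t x y.
Proof.
have [_ _ _ s _] := cRm; rewrite /weyl s (metricC x) (metricC y t) (metricC x t).
by rewrite (metricC y z) (ricciC x z) (ricciC y t) (ricciC y z) (ricciC x t); ring.
Qed.

(** The first Bianchi identity in the form that turns the contraction over the
    slots 2 and 4 in the Weyl action into one over the slots 3 and 4. *)
Lemma weyl_bianchi x y z t :
  weyl Rm x z y t - weyl Rm x t y z = weyl Rm x y z t.
Proof.
have [_ a a' s bi] := cRm; rewrite /weyl.
have -> : Rm x y z t = Rm x z y t - Rm x t y z.
  by have := bi x y z t; rewrite (a z x) (s y z) => *; lra.
rewrite (metricC z y) (metricC z t) (metricC t y) (ricciC z y) (ricciC t y).
by rewrite (ricciC z t); ring.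
Qed.

Lemma wedge_bivector (a b : T) : bivector (wedge a b : form2).
Proof.
split=> [y k x x'|x k y y'|x y]; rewrite /wedge ?metric_scalarr;
  by [apply: (_ : (_ : R) = _); ring].
Qed.

Lemma weyl_slots24 x y : bilinear_form (fun z t => weyl Rm x z y t).
Proof.
split=> t; have [h1 h2 _] := weyl_bivectorl y t; first exact: h2.
by move=> a z z'; rewrite !(weylC x t); have [h3 h4 _] := weyl_bivectorl x t; exact: h4.
Qed.

Lemma weyl_actionD (b b' : form2) :
  weyl_action Rm (b + b') = weyl_action Rm b + weyl_action Rm b'.
Proof. by apply/funext => x; apply/funext => y;
  exact: (pairingD (fun z t => weyl Rm x z y t)). Qed.

Lemma weyl_actionZ a (b : form2) :
  weyl_action Rm (a *: b) = a *: weyl_action Rm b.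
Proof. by apply/funext => x; apply/funext => y;
  exact: (pairingZ (fun z t => weyl Rm x z y t)). Qed.

Lemma weyl_action_wedge (v w : T) :
  weyl_action Rm (wedge v w) = (fun x y => weyl Rm x y v w).
Proof.
apply/funext => x; apply/funext => y.
by rewrite -weyl_bianchi; exact: (pairing_wedge _ _ (weyl_slots24 x y)).
Qed.

End Curvature.

(** * The volume form and the Hodge star in a frame *)

(** Iterated expansion along the first row.  The entries are given by a function on
    natural numbers, so that a minor is again of this form and the expansion is
    explicit at a given size. *)
Fixpoint laplace (R : comNzRingType) n (f : nat -> nat -> R) : R :=
  if n is n'.+1 then
    \sum_(j < n) (-1) ^+ j * f 0%N j * laplace n' (fun i k => f i.+1 (bump j k))
  else 1.

Lemma det_laplace (R : comNzRingType) n (f : nat -> nat -> R) :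
  \det (\matrix_(i < n, j < n) f i j) = laplace n f.
Proof.
elim: n f => [|n IH] f /=; first exact: det_mx00.
rewrite (expand_det_row _ ord0); apply: eq_bigr => j _.
rewrite mxE /cofactor add0n mulrA (mulrC (f _ _)) -IH; congr (_ * \det _).
by apply/matrixP => i k; rewrite !mxE.
Qed.

Section Volume.
Variables (R : realType) (T : oriented_euclidean4 R).
Implicit Types (x y z t : T).
Local Notation g := (metric T).
Local Notation form2 := (T -> T -> R^o).
Variable u : 4.-tuple T.
Hypothesis pu : positive_onb u.

Let ou : orthonormal g u. Proof. by have [] := pu. Qed.

(** Laplace expansion of a 4 x 4 determinant along its first two columns: the
    volume form matches each frame bivector with its dual one. *)
Lemma volume_laplace x y z t : volume x y z t =
    wedge u`_0 u`_1 x y * wedge u`_2 u`_3 z t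
  + wedge u`_2 u`_3 x y * wedge u`_0 u`_1 z t
  + wedge u`_0 u`_2 x y * wedge u`_3 u`_1 z t
  + wedge u`_3 u`_1 x y * wedge u`_0 u`_2 z t
  + wedge u`_0 u`_3 x y * wedge u`_1 u`_2 z t
  + wedge u`_1 u`_2 x y * wedge u`_0 u`_3 z t.
Proof.
rewrite (volume_onb _ _ _ _ pu).
rewrite (det_laplace 4 (fun i j => g u`_i [:: x; y; z; t]`_j)) /laplace.
rewrite !big_ord_recl !big_ord0 /= /bump /= !(add0n, add1n) /=.
by rewrite /wedge; ring.
Qed.

Lemma volume_slots34 x y : bilinear_form (volume x y).
Proof.
split=> [t a z z'|z a t t']; rewrite !volume_laplace /wedge !metric_scalarr; ring.
Qed.

Lemma hodgeD (b b' : form2) : hodge (b + b') = hodge b + hodge b'.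
Proof.
apply/funext => x; apply/funext => y.
by rewrite /hodge [X in _ * X](pairingD (volume x y)) mulrDr.
Qed.

Lemma hodgeZ a (b : form2) : hodge (a *: b) = a *: hodge b.
Proof.
apply/funext => x; apply/funext => y.
by rewrite /hodge [X in _ * X](pairingZ (volume x y)) mulrCA.
Qed.

Lemma hodge_wedge z t : hodge (wedge z t) = volume z t.
Proof.
apply/funext => x; apply/funext => y; rewrite /hodge.
rewrite [X in _ * X](pairing_wedge _ _ (volume_slots34 x y)).
by rewrite !volume_laplace /wedge; field.
Qed.

End Volume.

(** * Bases of self-dual and anti-self-dual bivectors *)

Section LambdaFrame.
Variables (R : realType) (T : oriented_euclidean4 R).
Implicit Types (x y z t : T).
Local Notation g := (metric T).
Local Notation form2 := (T -> T -> R^o).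

Lemma bivectorD (b b' : form2) : bivector b -> bivector b' -> bivector (b + b').
Proof.
move=> [l r a] [l' r' a']; split=> [y k x z|x k y z|x y].
- by transitivity (b (k *: x + z) y + b' (k *: x + z) y) => //;
    rewrite l l' addrACA -mulrDr.
- by transitivity (b x (k *: y + z) + b' x (k *: y + z)) => //;
    rewrite r r' addrACA -mulrDr.
- by transitivity (b x y + b' x y) => //; rewrite a a' -opprD.
Qed.

Lemma bivectorZ k (b : form2) : bivector b -> bivector (k *: b).
Proof.
move=> [l r a]; split=> [y h x z|x h y z|x y].
- by transitivity (k * b (h *: x + z) y) => //; rewrite l mulrDr mulrCA.
- by transitivity (k * b x (h *: y + z)) => //; rewrite r mulrDr mulrCA.
- by transitivity (k * b x y) => //; rewrite a mulrN.
Qed.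

Variable u : 4.-tuple T.
Hypothesis pu : positive_onb u.

Let ou : orthonormal g u. Proof. by have [] := pu. Qed.

Lemma volume_frame :
  [/\ (volume u`_0 u`_1 = wedge u`_2 u`_3) * (volume u`_2 u`_3 = wedge u`_0 u`_1),
      (volume u`_0 u`_2 = wedge u`_3 u`_1) * (volume u`_3 u`_1 = wedge u`_0 u`_2) &
      (volume u`_0 u`_3 = wedge u`_1 u`_2) * (volume u`_1 u`_2 = wedge u`_0 u`_3)].
Proof.
by split; split; apply/funext => z; apply/funext => t;
  rewrite (volume_laplace pu) /wedge !(frame_gramE ou) /=;
  apply: (_ : (_ : R) = _); ring.
Qed.

Lemma hodge_frame (b : form2) : bivector b ->
  [/\ hodge b u`_0 u`_1 = b u`_2 u`_3, hodge b u`_0 u`_2 = b u`_3 u`_1 &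
      hodge b u`_0 u`_3 = b u`_1 u`_2].
Proof.
move=> [l r a].
have dual v w z t : volume v w = wedge z t -> hodge b v w = b z t.
  move=> vE; rewrite /hodge vE.
  under eq_bigr do under eq_bigr do rewrite mulrC.
  rewrite [X in _ * X](pairing_wedge _ _ (conj l r)) (a t z).
  by apply: (_ : (_ : R) = _); field.
by have [h1 h2 h3] := volume_frame; split; apply: dual; rewrite ?h1 ?h2 ?h3.
Qed.

Lemma Lambda_frame_in sg i : Lambda sg (tnth (Lambda_frame u sg) i).
Proof.
have dual (a b : form2) : bivector a -> bivector b -> hodge a = b -> hodge b = a ->
    Lambda sg (a + (-1) ^+ sg *: b).
  move=> ab bb ha hb; split; first by apply: bivectorD => //; exact: bivectorZ.
  rewrite hodgeD hodgeZ ha hb scalerDr scalerA -signr_addb addbb scale1r.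
  by rewrite addrC.
have [h1 h2 h3] := volume_frame.
case: i => [[|[|[|?]]] ?] //; rewrite (tnth_nth 0) /=; apply: dual;
  by [exact: wedge_bivector | rewrite (hodge_wedge pu) ?h1 ?h2 ?h3].
Qed.

(** A bivector [w] is the sum of its six components; self-duality up to the sign
    [(-1) ^+ sg] expresses the components 34, 42, 23 through 12, 13, 14, and these
    three are the coordinates of [w]. *)
Lemma Lambda_frame_basis sg : basis_of_forms (Lambda sg) (Lambda_frame u sg).
Proof.
split=> [i|w [bw hw]]; first exact: Lambda_frame_in.
have sumE (a : {ffun 'I_3 -> R}) x y :
    (\sum_(i < 3) a i *: tnth (Lambda_frame u sg) i) x y =
    a ord0 * (wedge u`_0 u`_1 x y + (-1) ^+ sg * wedge u`_2 u`_3 x y)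
  + a (lift ord0 ord0) * (wedge u`_0 u`_2 x y + (-1) ^+ sg * wedge u`_3 u`_1 x y)
  + a ord_max * (wedge u`_0 u`_3 x y + (-1) ^+ sg * wedge u`_1 u`_2 x y).
  rewrite !big_ord_recl big_ord0 addr0 addrA !(tnth_nth 0) /=.
  by rewrite (_ : lift _ (lift _ _) = ord_max) //; apply: val_inj.
have [h1 h2 h3] := hodge_frame bw.
have cE x y : hodge w x y = (-1) ^+ sg * w x y by rewrite hw.
exists [ffun i : 'I_3 => w u`_0 u`_i.+1]; split.
  apply/funext => x; apply/funext => y; rewrite sumE !ffunE /=.
  rewrite (bivector_expand ou x y bw) -h1 -h2 -h3 !cE.
  by apply: (_ : (_ : R) = _); ring.
move=> a wE; apply/ffunP => i; rewrite ffunE wE sumE.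
case: i => [[|[|[|?]]] i3] //=; rewrite /wedge !(frame_gramE ou) /=.
- rewrite (_ : Ordinal _ = ord0); last exact: val_inj.
  by apply: (_ : (_ : R) = _); ring.
- rewrite (_ : Ordinal _ = lift ord0 ord0); last exact: val_inj.
  by apply: (_ : (_ : R) = _); ring.
- rewrite (_ : Ordinal _ = ord_max); last exact: val_inj.
  by apply: (_ : (_ : R) = _); ring.
Qed.

End LambdaFrame.

(** * Eigenbivectors of the Weyl tensor and 2 x 2 blocks *)

Section Blocks.
Variables (R : realType) (T : oriented_euclidean4 R).
Implicit Types (u : 4.-tuple T) (x y z t : T) (F : T -> T -> T -> T -> R).
Local Notation g := (metric T).
Local Notation form2 := (T -> T -> R^o).

(** As an operator on bivectors, [F] preserves the plane spanned by
    [wedge a b] and [wedge c d], with matrix [p, q; q, p'] there. *)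
Definition dual_block F (a b c d : T) (p p' q : R) := forall x y,
  F x y a b = p * wedge a b x y + q * wedge c d x y /\
  F x y c d = q * wedge a b x y + p' * wedge c d x y.

Definition frame_blocks F u (p0 p0' p1 p2 q0 q1 q2 : R) :=
  [/\ dual_block F u`_0 u`_1 u`_2 u`_3 p0 p0' q0,
      dual_block F u`_0 u`_2 u`_3 u`_1 p1 p1 q1 &
      dual_block F u`_0 u`_3 u`_1 u`_2 p2 p2 q2].

Variable Rm : T -> T -> T -> T -> R.
Hypothesis cRm : curvature_tensor Rm.

(** Eigenvectors [ab + cd] and [ab - cd] with the eigenvalues [p + q] and [p - q]
    are the diagonalization of the matrix [p, q; q, p] in the basis [ab, cd]. *)
Lemma dual_block_eigen (a b c d : T) (p q : R) :
  (forall sg : bool, weyl_action Rm (wedge a b + (-1) ^+ sg *: wedge c d) =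
     ((-1) ^+ sg * q + p) *: (wedge a b + (-1) ^+ sg *: wedge c d)) <->
  dual_block (weyl Rm) a b c d p p q.
Proof.
have actE (sg : bool) x y : weyl_action Rm (wedge a b + (-1) ^+ sg *: wedge c d) x y =
    weyl Rm x y a b + (-1) ^+ sg * weyl Rm x y c d.
  by rewrite weyl_actionD weyl_actionZ !(weyl_action_wedge cRm).
split=> [eig x y|blk sg].
  have evalE (sg : bool) : weyl Rm x y a b + (-1) ^+ sg * weyl Rm x y c d =
      ((-1) ^+ sg * q + p) * (wedge a b x y + (-1) ^+ sg * wedge c d x y).
    by rewrite -actE eig.
  have := evalE true; have := evalE false; rewrite expr0 expr1 => hp hm.
  by split; lra.
apply/funext => x; apply/funext => y; rewrite actE.
have [-> ->] := blk x y.
transitivity (((-1) ^+ sg * q + p) *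
    (wedge a b x y + (-1) ^+ sg * wedge c d x y)) => //.
by case: sg; apply: (_ : (_ : R) = _); ring.
Qed.

(** On the wedge of two eigenvectors of the Einstein tensor, the curvature
    differs from the Weyl tensor only by a multiple of that wedge. *)
Lemma weyl_ricci_eigen (a b : T) (mu nu : R) x y :
  (forall z, einstein Rm a z = mu * g a z) ->
  (forall z, einstein Rm b z = nu * g b z) ->
  Rm x y a b = weyl Rm x y a b
    + ((mu + nu) / 2 + scalar_curvature Rm / 12) * wedge a b x y.
Proof.
move=> ea eb; rewrite /weyl /wedge (ricciC cRm y b) (ricciC cRm x b).
rewrite (ricciC cRm y a) (ricciC cRm x a) !ricciE !ea !eb (metricC x) (metricC y b).
by rewrite (metricC y a) (metricC x b); field.
Qed.

Lemma weyl_blocks_curvature u lambda p1 p2 q0 q1 q2 (s := scalar_curvature Rm) :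
  diagonalized_form (einstein Rm) u [tuple - lambda; - lambda; lambda; lambda] ->
  frame_blocks (weyl Rm) u (- s / 12) (- s / 12) (p1 - s / 12) (p2 - s / 12) q0 q1 q2
  <-> frame_blocks Rm u (- lambda) lambda p1 p2 q0 q1 q2.
Proof.
move=> ediag.
have [/= e0 e1 e2 e3] : [/\ forall z, einstein Rm u`_0 z = - lambda * g u`_0 z,
    forall z, einstein Rm u`_1 z = - lambda * g u`_1 z,
    forall z, einstein Rm u`_2 z = lambda * g u`_2 z &
    forall z, einstein Rm u`_3 z = lambda * g u`_3 z].
  split=> z; first exact: (ediag (@Ordinal 4 0 isT)).
  - exact: (ediag (@Ordinal 4 1 isT)).
  - exact: (ediag (@Ordinal 4 2 isT)).
  - exact: (ediag (@Ordinal 4 3 isT)).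
have wE a b mu nu : (forall z, einstein Rm a z = mu * g a z) ->
  (forall z, einstein Rm b z = nu * g b z) -> forall x y, weyl Rm x y a b =
    Rm x y a b - ((mu + nu) / 2 + s / 12) * wedge a b x y.
  by move=> ea eb x y; rewrite (weyl_ricci_eigen x y ea eb) /s; ring.
rewrite /frame_blocks /dual_block.
split=> -[b1 b2 b3]; split=> x y.
- have [] := b1 x y; rewrite (wE _ _ _ _ e0 e1) (wE _ _ _ _ e2 e3); lra.
- have [] := b2 x y; rewrite (wE _ _ _ _ e0 e2) (wE _ _ _ _ e3 e1); lra.
- have [] := b3 x y; rewrite (wE _ _ _ _ e0 e3) (wE _ _ _ _ e1 e2); lra.
- have [] := b1 x y; rewrite (wE _ _ _ _ e0 e1) (wE _ _ _ _ e2 e3); lra.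
- have [] := b2 x y; rewrite (wE _ _ _ _ e0 e2) (wE _ _ _ _ e3 e1); lra.
- have [] := b3 x y; rewrite (wE _ _ _ _ e0 e3) (wE _ _ _ _ e1 e2); lra.
Qed.

Lemma curvature_data_weyl u s lambda xi c2 c3 c4 : positive_onb u ->
  curvature_data Rm u s lambda xi c2 c3 c4 <->
  [/\ scalar_curvature Rm = s,
      diagonalized_form (einstein Rm) u [tuple - lambda; - lambda; lambda; lambda] &
      frame_blocks (weyl Rm) u (- s / 12) (- s / 12) (xi - s / 12) (- xi + s / 6)
        c2 c3 c4].
Proof.
move=> pu; split=> -[sE ediag blk]; split=> //.
  split; apply/dual_block_eigen => sg; have [_ eig] := blk sg.
  - by have := eig (@Ordinal 3 0 isT); rewrite !(tnth_nth 0) /= mulNr.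
  - by have := eig (@Ordinal 3 1 isT); rewrite !(tnth_nth 0) /= addrA.
  - by have := eig (@Ordinal 3 2 isT); rewrite !(tnth_nth 0) /= addrA.
move=> sg; split; first exact: Lambda_frame_basis.
have [/dual_block_eigen b1 /dual_block_eigen b2 /dual_block_eigen b3] := blk.
case=> [[|[|[|?]]] ?] //; rewrite !(tnth_nth 0) /=.
- by rewrite b1 mulNr.
- by rewrite b2 addrA.
- by rewrite b3 addrA.
Qed.

(** The prescribed data say exactly that the curvature operator splits into three
    2 x 2 blocks over the dual pairs.  The Einstein tensor separates the two
    diagonal entries of the first block and cancels in the other two, where the
    frame eigenvalues are opposite. *)
Lemma curvature_data_blocks u s lambda xi c2 c3 c4 : positive_onb u ->
  curvature_data Rm u s lambda xi c2 c3 c4 <->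
  [/\ scalar_curvature Rm = s,
      diagonalized_form (einstein Rm) u [tuple - lambda; - lambda; lambda; lambda] &
      frame_blocks Rm u (- lambda) lambda xi (s / 4 - xi) c2 c3 c4].
Proof.
move=> pu; rewrite curvature_data_weyl //.
have p2E : - xi + s / 6 = (s / 4 - xi) - s / 12 by field.
by split=> -[sE ediag blk]; split=> //; move: blk;
  have := weyl_blocks_curvature xi (s / 4 - xi) c2 c3 c4 ediag;
  rewrite sE -p2E => -[].
Qed.

End Blocks.

(** * The quadratic contraction of the curvature *)

Section Square.
Variables (R : realType) (T : oriented_euclidean4 R).
Implicit Types (x y z t : T).
Local Notation g := (metric T).
Local Notation e i := (onb T)`_(nat_of_ord i).
Local Notation form2 := (T -> T -> R^o).
Variable u : 4.-tuple T.
Hypothesis ou : orthonormal g u.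

(** Half of the full contraction of two bivectors in the frame. *)
Definition frame_dot (b b' : T -> T -> R) : R :=
  b u`_0 u`_1 * b' u`_0 u`_1 + b u`_2 u`_3 * b' u`_2 u`_3
  + (b u`_0 u`_2 * b' u`_0 u`_2 + b u`_3 u`_1 * b' u`_3 u`_1)
  + (b u`_0 u`_3 * b' u`_0 u`_3 + b u`_1 u`_2 * b' u`_1 u`_2).

Lemma pairing_frame (b b' : form2) : bivector b -> bivector b' ->
  pairing b b' = 2 * frame_dot b b'.
Proof.
move=> [l r a] bb'; have blb : bilinear_form b by split.
rewrite {1}(_ : b' = b' u`_0 u`_1 *: wedge u`_0 u`_1 + b' u`_2 u`_3 *: wedge u`_2 u`_3
  + (b' u`_0 u`_2 *: wedge u`_0 u`_2 + b' u`_3 u`_1 *: wedge u`_3 u`_1)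
  + (b' u`_0 u`_3 *: wedge u`_0 u`_3 + b' u`_1 u`_2 *: wedge u`_1 u`_2)); last first.
  by apply/funext => x; apply/funext => y; exact: bivector_expand.
have pE c z t : pairing b (c *: wedge z t) = 2 * c * b z t.
  by rewrite pairingZ pairing_wedge // (a t z); apply: (_ : (_ : R) = _); ring.
by rewrite !pairingD !pE /frame_dot; ring.
Qed.

Variable Rm : T -> T -> T -> T -> R.
Hypothesis cRm : curvature_tensor Rm.

Definition curvature_square x y : R :=
  \sum_(k < 4) \sum_(p < 4) \sum_(q < 4)
    Rm x (e k) (e p) (e q) * Rm y (e k) (e p) (e q).

Lemma curvature_square_frame x y :
  curvature_square x y =
  2 * (frame_dot (Rm x u`_0) (Rm y u`_0) + frame_dot (Rm x u`_1) (Rm y u`_1)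
     + (frame_dot (Rm x u`_2) (Rm y u`_2) + frame_dot (Rm x u`_3) (Rm y u`_3))).
Proof.
have [[_ l2 _ _] _ _ _ _] := cRm.
pose B z t := frame_dot (Rm x z) (Rm y t).
transitivity (\sum_(k < 4) 2 * B (e k) (e k)).
  by apply: eq_bigr => k _; apply: pairing_frame; exact: curvature_bivectorr.
rewrite -mulr_sumr (contraction_onb _ _ ou).
- by rewrite !big_ord_recl big_ord0 addr0 /B /= !addrA.
- by move=> t a z z'; rewrite /B /frame_dot !l2; ring.
- by move=> z a t t'; rewrite /B /frame_dot !l2; ring.
Qed.

(** The image of a frame bivector is a combination of itself and its dual.  A frame
    bivector contracted with itself is the projection onto its plane, and dual
    bivectors contract to zero.  The two planes of a dual pair add up to the
    whole space, so each block with equal squares on the diagonal contributes a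
    multiple of the metric. *)
Lemma blocks_square p0 p0' p1 p2 q0 q1 q2 : p0' ^+ 2 = p0 ^+ 2 ->
  frame_blocks Rm u p0 p0' p1 p2 q0 q1 q2 -> forall x y, curvature_square x y =
  2 * (p0 ^+ 2 + q0 ^+ 2 + p1 ^+ 2 + q1 ^+ 2 + p2 ^+ 2 + q2 ^+ 2) * g x y.
Proof.
move=> pp [b0 b1 b2] x y; rewrite curvature_square_frame /frame_dot.
have [E0 E0'] := (fun z t => (b0 z t).1, fun z t => (b0 z t).2).
have [E1 E1'] := (fun z t => (b1 z t).1, fun z t => (b1 z t).2).
have [E2 E2'] := (fun z t => (b2 z t).1, fun z t => (b2 z t).2).
rewrite !E0 !E0' !E1 !E1' !E2 !E2' /wedge !(frame_gramE ou) /=.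
rewrite (frame_expand ou y (metric_scalarr x)) !(metricC x).
by ring: pp.
Qed.

End Square.

(** * Components outside the blocks *)

Section Components.
Variables (R : realType) (T : oriented_euclidean4 R).
Local Notation g := (metric T).

Definition symmetry_orbit (i j k l : nat) :=
  [:: (i, j, k, l); (j, i, k, l); (i, j, l, k); (j, i, l, k);
      (k, l, i, j); (k, l, j, i); (l, k, i, j); (l, k, j, i)].

Lemma symmetry_orbit_related i j k l p q r m :
  (p, q, r, m) \in symmetry_orbit i j k l -> algebraically_related i j k l p q r m.
Proof.
have r1 : algebraically_related i j k l i j k l by exact: related_refl.
have r2 : algebraically_related i j k l j i k l by exact: related_swapl.
have r3 : algebraically_related i j k l i j l k by exact: related_swapr.
have r4 : algebraically_related i j k l j i l k by exact: related_swapl.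
rewrite !inE; do 7!(case/orP; first by case/eqP=> -> -> -> -> //; exact: related_pairs).
by case/eqP=> -> -> -> ->; exact: related_pairs.
Qed.

Definition block_components : seq (nat * nat * nat * nat) :=
  [:: (0, 1, 0, 1); (0, 2, 0, 2); (0, 3, 0, 3); (2, 3, 2, 3); (1, 3, 1, 3);
      (1, 2, 1, 2); (0, 1, 2, 3); (0, 2, 3, 1); (0, 3, 1, 2)]%N.

Definition in_blocks (i j k l : nat) :=
  has (fun '(a, b, c, d) => (i, j, k, l) \in symmetry_orbit a b c d) block_components.

Variable u : 4.-tuple T.
Hypothesis ou : orthonormal g u.

(** The image of a frame bivector involves only itself and its dual, so a component
    survives only if its two pairs of indices agree or are complementary.  Both
    conditions are checked on the 256 quadruples. *)
Lemma frame_blocks_vanish (F : T -> T -> T -> T -> R) p0 p0' p1 p2 q0 q1 q2 :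
  (forall x y z t, F x y z t = - F x y t z) ->
  frame_blocks F u p0 p0' p1 p2 q0 q1 q2 ->
  forall i j k l : 'I_4, ~~ in_blocks i j k l -> F u`_i u`_j u`_k u`_l = 0.
Proof.
move=> Fa [b0 b1 b2] i j k l.
have [E0 E0'] := (fun z t => (b0 z t).1, fun z t => (b0 z t).2).
have [E1 E1'] := (fun z t => (b1 z t).1, fun z t => (b1 z t).2).
have [E2 E2'] := (fun z t => (b2 z t).1, fun z t => (b2 z t).2).
have F0 x y z : F x y z z = 0 by have := Fa x y z z; lra.
case: k => [[|[|[|[|//]]]] k4]; case: l => [[|[|[|[|//]]]] l4] /=;
  rewrite ?F0 // ?(Fa _ _ u`_1 u`_0) ?(Fa _ _ u`_2 u`_0) ?(Fa _ _ u`_3 u`_0)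
    ?(Fa _ _ u`_2 u`_1) ?(Fa _ _ u`_1 u`_3) ?(Fa _ _ u`_3 u`_2)
    ?E0 ?E0' ?E1 ?E1' ?E2 ?E2' // /wedge;
  case: i => [[|[|[|[|//]]]] i4]; case: j => [[|[|[|[|//]]]] j4] //= _;
  rewrite !(frame_gramE ou) /=; ring.
Qed.

End Components.

(** * Curvature tensors with the prescribed data *)

Section Converse.
Variables (R : realType) (T : oriented_euclidean4 R).
Local Notation g := (metric T).
Variables (u : 4.-tuple T) (s lambda xi c2 c3 c4 : R).
Variable Rm : T -> T -> T -> T -> R.
Hypothesis (pu : positive_onb u) (cRm : curvature_tensor Rm).
Hypothesis data : curvature_data Rm u s lambda xi c2 c3 c4.

Let ou : orthonormal g u. Proof. by have [] := pu. Qed.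

Lemma curvature_data_weakly_einstein : weakly_einstein Rm.
Proof.
have [_ _ blk] := (curvature_data_blocks cRm s lambda xi c2 c3 c4 pu).1 data.
eexists => x y; apply: (blocks_square ou cRm _ blk); exact/esym/sqrrN.
Qed.

Let W (i j k l : nat) := weyl Rm u`_i u`_j u`_k u`_l.

Lemma curvature_data_weyl_vanish (i j k l : 'I_4) :
  (forall c, c \in block_components ->
     let: (p, q, r, m) := c in ~ algebraically_related p q r m i j k l) ->
  W i j k l = 0.
Proof.
have [_ _ blk] := (curvature_data_weyl cRm s lambda xi c2 c3 c4 pu).1 data.
move=> unrelated; apply: (frame_blocks_vanish ou _ blk).
  by move=> x y z t; rewrite weylC // (weylC cRm x); have [_ _ ->] := weyl_bivectorl cRm x y.
apply/hasPn => -[[[p q] r] m] /unrelated nrel.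
by apply/negP => /symmetry_orbit_related.
Qed.

Lemma curvature_data_weyl_components :
  [/\ (W 0 1 0 1, W 0 2 0 2, W 0 3 0 3) = (- s / 12, xi - s / 12, - xi + s / 6),
      (W 2 3 2 3, W 1 3 1 3, W 1 2 1 2) = (- s / 12, xi - s / 12, - xi + s / 6) &
      (W 0 1 2 3, W 0 2 3 1, W 0 3 1 2) = (c2, c3, c4)].
Proof.
have [_ _ [b0 b1 b2]] := (curvature_data_weyl cRm s lambda xi c2 c3 c4 pu).1 data.
have [E0 E0'] := (fun z t => (b0 z t).1, fun z t => (b0 z t).2).
have [E1 E1'] := (fun z t => (b1 z t).1, fun z t => (b1 z t).2).
have [E2 E2'] := (fun z t => (b2 z t).1, fun z t => (b2 z t).2).
have W13 : W 1 3 1 3 = weyl Rm u`_3 u`_1 u`_3 u`_1.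
  have [_ _ wa] := weyl_bivectorl cRm u`_1 u`_3.
  have [_ _ wa'] := weyl_bivectorl cRm u`_3 u`_1.
  by rewrite /W wa (weylC cRm) wa' opprK.
rewrite W13 /W !E0 !E0' !E1 !E1' !E2 !E2' /wedge !(frame_gramE ou) /=.
by split; congr (_, _, _); ring.
Qed.

End Converse.

(** * Eigenframes of the Einstein tensor *)

Section EigenFrame.
Variables (R : realType) (T : oriented_euclidean4 R).
Implicit Types (x y z t : T).
Local Notation g := (metric T).

Lemma normalize_in (U : {vspace T}) x : x \in U -> x != 0 ->
  exists k, [/\ k *: x \in U & g (k *: x) (k *: x) = 1].
Proof.
move=> xU x0; have gx : 0 < g x x by apply: neq0_dnorm_gt0.
exists (Num.sqrt (g x x))^-1; split; first exact: rpredZ.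
rewrite metricZr metricZl mulrA -invfM -expr2 sqr_sqrtr ?ltW //.
by rewrite mulVf // gt_eqF.
Qed.

Lemma orthonormal_pair (U : {vspace T}) : \dim U = 2 ->
  exists x y, [/\ x \in U, y \in U, g x x = 1, g y y = 1 & g x y = 0].
Proof.
move=> dU.
have U0 : vpick U != 0 by rewrite vpick0 -dimv_eq0 dU.
have [k] := normalize_in (memv_pick U) U0; set x := _ *: _ => -[xU gx].
(* A vector of U off the line of x exists by dimension; subtracting its
   projection to x makes it orthogonal to x. *)
have [w [wU wx]] : exists w, w \in U /\ w \notin <[x]>%VS.
  apply: contrapT => /forallNP h.
  have : (U <= <[x]>)%VS.
    by apply/subvP => w wU; apply/negPn/negP => wx; apply: (h w).
  by move/dimvS; rewrite dU dim_vline; case: (x != 0).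
pose y := w - g x w *: x.
have yU : y \in U by rewrite rpredB // rpredZ.
have y0 : y != 0.
  by apply: contra wx; rewrite subr_eq0 => /eqP ->; rewrite rpredZ // memv_line.
have [h [hU gy]] := normalize_in yU y0.
exists x, (h *: y); split=> //.
by rewrite metricZr linearBr /= metricZr gx mulr1 subrr mulr0.
Qed.

Variable Rm : T -> T -> T -> T -> R.
Hypothesis cRm : curvature_tensor Rm.

Lemma einstein_traceless (v : 4.-tuple T) : orthonormal g v ->
  \sum_(i < 4) einstein Rm v`_i v`_i = 0.
Proof.
move=> ov; rewrite /einstein sumrB -(scalar_curvature_onb cRm ov).
rewrite (eq_bigr (fun=> scalar_curvature Rm / 4)) => [|i _].
  by rewrite sumr_const card_ord -mulr_natr; field.
by rewrite (frame_gram ov) ?ltn_ord // eqxx mulr1.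
Qed.

Definition eigenframe (v : 4.-tuple T) (lambda : R) :=
  orthonormal g v /\
  diagonalized_form (einstein Rm) v [tuple - lambda; - lambda; lambda; lambda].

(** Eigenspaces of distinct eigenvalues are orthogonal, so orthonormal bases of the
    two planes make a frame; tracelessness makes the eigenvalues opposite, and the
    plane of the negative one is listed first. *)
Lemma eigenframe_exists : two_distinct_double_eigenvalues (einstein Rm) ->
  exists (v : 4.-tuple T) lambda, 0 < lambda /\ eigenframe v lambda.
Proof.
case=> a0 [a1 [a01 ev0 ev1]].
wlog lt01 : a0 a1 a01 ev0 ev1 / a0 < a1.
  move=> wl; have [|lt10|/a01//] := ltgtP a0 a1; first exact: wl.
  by apply: (wl a1 a0) => // /esym.
have [U0 eU0 /orthonormal_pair[x [y [/eU0 ex /eU0 ey gxx gyy gxy]]]] := ev0.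
have [U1 eU1 /orthonormal_pair[z [t [/eU1 ez /eU1 et gzz gtt gzt]]]] := ev1.
have orth p q : (forall w, einstein Rm p w = a0 * g p w) ->
    (forall w, einstein Rm q w = a1 * g q w) -> g p q = 0.
  move=> ep eq; have := einsteinC cRm p q; rewrite ep eq (metricC q p) => h.
  have : (a1 - a0) * g p q = 0 by rewrite mulrBl h subrr.
  by move/eqP; rewrite mulf_eq0 subr_eq0 eq_sym lt_eqF //= => /eqP.
pose v := [tuple x; y; z; t].
have ov : orthonormal g v.
  apply/orthonormal_gram => -[[|[|[|[|//]]]] i4] -[[|[|[|[|//]]]] j4] /=;
  by rewrite ?gxx ?gyy ?gzz ?gtt ?gxy ?gzt ?(metricC y x) ?(metricC t z)
    ?gxy ?gzt ?(metricC z) ?(metricC t) ?orth.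
have := einstein_traceless ov.
rewrite !big_ord_recl big_ord0 /= ex ey ez et gxx gyy gzz gtt => tr.
have a0E : a0 = - a1 by lra.
exists v, a1; split; first by lra.
by split=> // -[[|[|[|[|//]]]] i4] w /=; rewrite -?a0E.
Qed.

End EigenFrame.

(** * Rotations of the two eigenplanes *)

Section Rotation.
Variable R : realType.

(** A square root of the unit complex number [a + i b]. *)
Lemma half_angle (a b : R) : a ^+ 2 + b ^+ 2 = 1 ->
  exists c s, [/\ c ^+ 2 + s ^+ 2 = 1, a = c ^+ 2 - s ^+ 2 & b = 2 * c * s].
Proof.
move=> ab; have [a1|a1] := eqVneq (1 + a) 0.
  have aE : a = -1 by lra.
  have : b ^+ 2 = 0 by rewrite aE in ab; lra.
  by move/eqP; rewrite sqrf_eq0 => /eqP ->; exists 0, 1; split; rewrite ?aE; ring.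
have a1_gt0 : 0 < 1 + a by rewrite lt_neqAle eq_sym a1 /=; nra.
pose c := Num.sqrt ((1 + a) / 2).
have c2 : c ^+ 2 = (1 + a) / 2 by rewrite sqr_sqrtr // ltW // divr_gt0.
have c0 : c != 0 by rewrite gt_eqF // sqrtr_gt0 divr_gt0.
have s2 : (b / (2 * c)) ^+ 2 = (1 - a) / 2.
  have -> : (b / (2 * c)) ^+ 2 = b ^+ 2 / (4 * c ^+ 2) by field.
  have -> : b ^+ 2 = (1 - a) * (1 + a) by lra.
  by rewrite c2; field.
by exists c, (b / (2 * c)); split; rewrite ?c2 ?s2; field.
Qed.

(** The left side is the off-diagonal entry of a symmetric 2 x 2 matrix, with
    off-diagonal entry [q] and difference [p] of diagonal entries, after a rotation
    by twice the angle of [(c, s)].  Cancelling it fixes the quadruple of that angle,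
    up to a half turn, so the angle is reached by halving twice. *)
Lemma quarter_angle (p q : R) : exists c s, c ^+ 2 + s ^+ 2 = 1 /\
  let C := c ^+ 2 - s ^+ 2 in let S := 2 * c * s in
  (C ^+ 2 - S ^+ 2) * q - C * S * p = 0.
Proof.
(* (a, b) is the unit vector of the quadruple angle. *)
have [a [b [ab abpq]]] : exists a b, a ^+ 2 + b ^+ 2 = 1 /\ a * q - b / 2 * p = 0.
  have [n0|n0] := eqVneq ((p / 2) ^+ 2 + q ^+ 2) 0.
    have p0 : p = 0 by nra.
    have q0 : q = 0 by nra.
    by exists 1, 0; rewrite p0 q0; split; ring.
  have n_gt0 : 0 < (p / 2) ^+ 2 + q ^+ 2.
    by rewrite lt_neqAle eq_sym n0 addr_ge0 // sqr_ge0.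
  pose n := Num.sqrt ((p / 2) ^+ 2 + q ^+ 2).
  have n2 : n ^+ 2 = (p / 2) ^+ 2 + q ^+ 2 by rewrite sqr_sqrtr // ltW.
  have nn0 : n != 0 by rewrite gt_eqF // sqrtr_gt0.
  exists (p / 2 / n), (q / n); split; last by field.
  have -> : (p / 2 / n) ^+ 2 + (q / n) ^+ 2 = ((p / 2) ^+ 2 + q ^+ 2) / n ^+ 2.
    by field.
  by rewrite n2 divff.
have [C [S [CS aE bE]]] := half_angle ab.
have [c [s [cs CE SE]]] := half_angle CS.
exists c, s; split=> //=.
by rewrite -CE -SE -aE -[RHS]abpq bE; field.
Qed.

Variable T : oriented_euclidean4 R.
Implicit Types (v : 4.-tuple T) (x y z t : T) (eps : R).
Local Notation g := (metric T).
Local Notation form2 := (T -> T -> R^o).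

(** Rotates the plane of the first two frame vectors by the angle of [(c, s)], and
    the plane of the last two by the same angle times [eps = 1] or [eps = -1]. *)
Definition rotate v (c s eps : R) : 4.-tuple T :=
  [tuple c *: v`_0 + s *: v`_1; - s *: v`_0 + c *: v`_1;
         c *: v`_2 + (eps * s) *: v`_3; - (eps * s) *: v`_2 + c *: v`_3].

(** [dual2] and [dual3] are the values of a form on the second and third vectors
    [u1 ^ u3 + eps u4 ^ u2] and [u1 ^ u4 + eps u2 ^ u3] of the frame of self-dual
    ([eps = 1]) or anti-self-dual ([eps = -1]) bivectors. *)
Definition dual2 eps (b : T -> T -> R) v : R := b v`_0 v`_2 + eps * b v`_3 v`_1.
Definition dual3 eps (b : T -> T -> R) v : R := b v`_0 v`_3 + eps * b v`_1 v`_2.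

(** On the bivectors of duality [eps] the two rotations add up to one by the double
    angle, with the sense given by [eps]. *)
Lemma rotate_dual (b : form2) v c s eps : bivector b -> eps ^+ 2 = 1 ->
  (dual2 eps b (rotate v c s eps) =
     (c ^+ 2 - s ^+ 2) * dual2 eps b v + eps * (2 * c * s) * dual3 eps b v) *
  (dual3 eps b (rotate v c s eps) =
     (c ^+ 2 - s ^+ 2) * dual3 eps b v - eps * (2 * c * s) * dual2 eps b v).
Proof.
move=> [l r a] eps2; rewrite /dual2 /dual3 /=.
rewrite !(scalar_comb _ _ _ _ (l _)) !(scalar_comb _ _ _ _ (r _)).
rewrite (a v`_2 v`_0) (a v`_3 v`_0) (a v`_2 v`_1) (a v`_3 v`_1).
by split; ring: eps2.
Qed.

(** On the bivectors of the opposite duality the two rotations cancel. *)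
Lemma rotate_codual (b : form2) v c s eps : bivector b -> eps ^+ 2 = 1 ->
  c ^+ 2 + s ^+ 2 = 1 ->
  (dual2 (- eps) b (rotate v c s eps) = dual2 (- eps) b v) *
  (dual3 (- eps) b (rotate v c s eps) = dual3 (- eps) b v).
Proof.
move=> [l r a] eps2 /(canRL (addrK _)) cs; rewrite /dual2 /dual3 /=.
rewrite !(scalar_comb _ _ _ _ (l _)) !(scalar_comb _ _ _ _ (r _)).
rewrite (a v`_2 v`_0) (a v`_3 v`_0) (a v`_2 v`_1) (a v`_3 v`_1).
by split; ring: eps2 cs.
Qed.

Variable Rm : T -> T -> T -> T -> R.
Hypothesis cRm : curvature_tensor Rm.

(** The curvature, as a quadratic form on bivectors, at the second and third vectors
    of the (anti-)self-dual frame.  The scalar part is diagonal and the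
    Einstein part exchanges the two dualities, so this is, up to a constant factor,
    an off-diagonal entry of the Weyl operator. *)
Definition mixed eps v : R := dual2 eps (fun x y => dual3 eps (Rm x y) v) v.

Lemma dual3_bivector eps v : bivector ((fun x y => dual3 eps (Rm x y) v) : form2).
Proof.
have [[l1 l2 _ _] a _ _ _] := cRm.
split=> [y k x z|x k y z|x y]; rewrite /dual3 ?l1 ?l2 //; last rewrite !(a x);
  apply: (_ : (_ : R) = _); ring.
Qed.

Lemma mixed_rotate eps v c s (C := c ^+ 2 - s ^+ 2) (S := 2 * c * s) :
  eps ^+ 2 = 1 ->
  mixed eps (rotate v c s eps) = (C ^+ 2 - S ^+ 2) * mixed eps v
    - C * S * (eps * (dual2 eps (fun x y => dual2 eps (Rm x y) v) v
                    - dual3 eps (fun x y => dual3 eps (Rm x y) v) v)).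
Proof.
move=> eps2; have [_ _ _ sR _] := cRm.
pose f x y := dual3 eps (Rm x y) (rotate v c s eps).
have fE x y : f x y = C * dual3 eps (Rm x y) v - eps * S * dual2 eps (Rm x y) v.
  by rewrite /f rotate_dual //; exact: curvature_bivectorr.
rewrite /mixed -/f rotate_dual //; last exact: dual3_bivector.
rewrite -/C -/S /dual2 /dual3 !fE /dual2 /dual3.
rewrite (sR v`_0 v`_3 v`_0 v`_2) (sR v`_0 v`_3 v`_3 v`_1).
rewrite (sR v`_1 v`_2 v`_0 v`_2) (sR v`_1 v`_2 v`_3 v`_1).
by ring: eps2.
Qed.

Lemma mixed_corotate eps v c s : eps ^+ 2 = 1 -> c ^+ 2 + s ^+ 2 = 1 ->
  mixed (- eps) (rotate v c s eps) = mixed (- eps) v.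
Proof.
move=> eps2 cs; rewrite /mixed rotate_codual //; last exact: dual3_bivector.
rewrite /dual2; congr (_ + _ * _); rewrite rotate_codual //;
  exact: curvature_bivectorr.
Qed.

Lemma rotate_eigenframe v lambda c s eps : eps ^+ 2 = 1 -> c ^+ 2 + s ^+ 2 = 1 ->
  eigenframe Rm v lambda -> eigenframe Rm (rotate v c s eps) lambda.
Proof.
move=> eps2 /(canRL (addrK _)) cs [ov ev]; split.
  apply/orthonormal_gram => i j.
  case: i => [[|[|[|[|//]]]] i4]; case: j => [[|[|[|[|//]]]] j4] /=;
  rewrite !(scalar_comb _ _ _ _ (metric_scalarl _)) !(scalar_comb _ _ _ _ (metric_scalarr _));
  rewrite !(frame_gramE ov) /=; ring: eps2 cs.
have e0 := ev (@Ordinal 4 0 isT); have e1 := ev (@Ordinal 4 1 isT).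
have e2 := ev (@Ordinal 4 2 isT); have e3 := ev (@Ordinal 4 3 isT).
move=> [[|[|[|[|//]]]] i4] y /=; rewrite (scalar_comb _ _ _ _ (einstein_scalarl cRm _))
  (scalar_comb _ _ _ _ (metric_scalarl _)) ?e0 ?e1 ?e2 ?e3 /=; ring.
Qed.

(** The two dualities can be treated one after the other, because the rotation that
    diagonalizes one of them leaves the other untouched. *)
Lemma unmixed_eigenframe v lambda : eigenframe Rm v lambda ->
  exists w, [/\ eigenframe Rm w lambda, mixed 1 w = 0 & mixed (-1) w = 0].
Proof.
have unmix eps w : eps ^+ 2 = 1 -> eigenframe Rm w lambda ->
    exists w', [/\ eigenframe Rm w' lambda, mixed eps w' = 0 &
                   mixed (- eps) w' = mixed (- eps) w].
  move=> eps2 ew; have [c [s [cs mE]]] := quarter_angle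
    (eps * (dual2 eps (fun x y => dual2 eps (Rm x y) w) w
          - dual3 eps (fun x y => dual3 eps (Rm x y) w) w)) (mixed eps w).
  exists (rotate w c s eps); split; first exact: rotate_eigenframe.
    by rewrite mixed_rotate.
  exact: mixed_corotate.
move=> /(unmix 1 _ (expr1n _ _))[w [ew mw _]].
have [//|w' [ew' mw']] := unmix (-1) w _ ew; first by rewrite sqrrN expr1n.
by rewrite opprK mw => m1; exists w'.
Qed.

End Rotation.

(** * The weakly Einstein equations in components *)

Section Algebra.
Variable R : realFieldType.

(** The variables are the components of the curvature operator, a symmetric 6 x 6
    matrix whose indices A, ..., F stand for the bivectors 12, 34, 13, 42, 14, 23;
    [r] is a quarter of the scalar curvature.  The hypotheses are, in order: the
    diagonal Ricci components, the off-diagonal ones, the vanishing of both mixed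
    entries, and the equality or vanishing of entries of the quadratic contraction
    of the curvature (11 against 33, then 13, 14, 23, 24).  The linear equations
    leave nine unknowns.  After their substitution the difference of
    the two sides of each quadratic equation is [lambda] times a linear expression,
    because the only part of the contraction that is not a multiple of the metric
    is a product of the Einstein tensor with the Weyl and scalar parts. *)
Lemma block_equations
    (lambda r AA AB AC AD AE AF BB BC BD BE BF CC CD CE CF DD DE DF EE EF FF : R) :
  0 < lambda ->
  (AA + CC + EE = r - lambda /\ AA + DD + FF = r - lambda) ->
  (BB + CC + FF = r + lambda /\ BB + DD + EE = r + lambda) ->
  [/\ CF = DE, BE = AF, BC = AD, BD = AC & BF = AE] -> CE = DF ->
  CE + CF + (DE + DF) = 0 -> CE - CF - (DE - DF) = 0 ->
  AA * AA + AB * AB + (AC * AC + AD * AD) + (AE * AE + AF * AF)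
  + (AE * AE + BE * BE + (CE * CE + DE * DE) + (EE * EE + EF * EF))
  = (AF * AF + BF * BF + (CF * CF + DF * DF) + (EF * EF + FF * FF))
    + (AB * AB + BB * BB + (BC * BC + BD * BD) + (BE * BE + BF * BF)) ->
  AA * AF + AB * BF + (AC * CF + AD * DF) + (AE * EF + AF * FF)
  = AB * AE + BB * BE + (BC * CE + BD * DE) + (BE * EE + BF * EF) ->
  AA * AD + AB * BD + (AC * CD + AD * DD) + (AE * DE + AF * DF)
  = AB * AC + BB * BC + (BC * CC + BD * CD) + (BE * CE + BF * CF) ->
  AA * AC + AB * BC + (AC * CC + AD * CD) + (AE * CE + AF * CF)
  = AB * AD + BB * BD + (BC * CD + BD * DD) + (BE * DE + BF * DF) ->
  AA * AE + AB * BE + (AC * CE + AD * DE) + (AE * EE + AF * EF)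
  = AB * AF + BB * BF + (BC * CF + BD * DF) + (BE * EF + BF * FF) ->
  [/\ [/\ AA = - lambda, BB = lambda, DD = CC, EE = r - CC & FF = r - CC],
      [/\ AC = 0, AD = 0, AE = 0 & AF = 0],
      [/\ BC = 0, BD = 0, BE = 0 & BF = 0] &
      [/\ CE = 0, CF = 0, DE = 0 & DF = 0]].
Proof.
move=> l0 [r0 r1] [r2 r3] [-> -> -> -> ->] r23 m1 m2 q00 q02 q03 q12 q13.
have CE0 : CE = 0 by lra.
have DE0 : DE = 0 by lra.
have DF0 : DF = 0 by lra.
have BBE : BB = AA + 2 * lambda by lra.
have DDE : DD = CC by lra.
have EEE : EE = r - lambda - AA - CC by lra.
have FFE : FF = r - lambda - AA - CC by lra.
clear r0 r1 r2 r3 r23 m1 m2; subst.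
have cancel x : lambda * x = 0 -> x = 0.
  by move/eqP; rewrite mulf_eq0 gt_eqF //= => /eqP.
(* The linear equations have turned the difference of the two sides of each
   quadratic one into a multiple of lambda times the quantity that has to vanish. *)
have AAE : AA = - lambda.
  by apply/eqP; rewrite -addr_eq0; apply/eqP/cancel; lra.
subst; clear q00.
have AF0 : AF = 0 by apply: cancel; lra.
have AD0 : AD = 0 by apply: cancel; lra.
have AC0 : AC = 0 by apply: cancel; lra.
have AE0 : AE = 0 by apply: cancel; lra.
by split; split=> //; lra.
Qed.

End Algebra.

Section Core.
Variables (R : realType) (T : oriented_euclidean4 R).
Implicit Types (x y z t : T).
Local Notation g := (metric T).
Variable Rm : T -> T -> T -> T -> R.
Hypothesis cRm : curvature_tensor Rm.
Variables (v : 4.-tuple T) (lambda : R).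
Hypothesis (ev : eigenframe Rm v lambda).

Let ov : orthonormal g v. Proof. by have [] := ev. Qed.

Lemma eigenframe_ricci :
  [/\ forall x, ricci Rm v`_0 x = (scalar_curvature Rm / 4 - lambda) * g v`_0 x,
      forall x, ricci Rm v`_1 x = (scalar_curvature Rm / 4 - lambda) * g v`_1 x,
      forall x, ricci Rm v`_2 x = (scalar_curvature Rm / 4 + lambda) * g v`_2 x &
      forall x, ricci Rm v`_3 x = (scalar_curvature Rm / 4 + lambda) * g v`_3 x].
Proof.
have [_ ed] := ev; split=> x; rewrite ricciE.
- by rewrite (ed (@Ordinal 4 0 isT)) /=; ring.
- by rewrite (ed (@Ordinal 4 1 isT)) /=; ring.
- by rewrite (ed (@Ordinal 4 2 isT)) /=; ring.
- by rewrite (ed (@Ordinal 4 3 isT)) /=; ring.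
Qed.

(** In the frame, the hypotheses become the premises of [block_equations]; as a
    bivector is determined by its frame components, its conclusion gives the
    blocks. *)
Lemma eigenframe_blocks : 0 < lambda -> weakly_einstein Rm ->
  mixed Rm 1 v = 0 -> mixed Rm (-1) v = 0 ->
  exists xi c2 c3 c4 : R, c2 + c3 + c4 = 0 /\
    frame_blocks Rm v (- lambda) lambda xi (scalar_curvature Rm / 4 - xi) c2 c3 c4.
Proof.
move=> l0 [a we] m1 m2.
have [_ l r s bi] := cRm.
have [ric0 ric1 ric2 ric3] := eigenframe_ricci.
have L0 x z t : Rm x x z t = 0 by have := l x x z t; lra.
have R0 x y z : Rm x y z z = 0 by have := r x y z z; lra.
(* Oriented rewrite rules to the canonical order of the pairs of indices. *)
have left := (l v`_1 v`_0, l v`_3 v`_2, l v`_2 v`_0, l v`_1 v`_3, l v`_3 v`_0,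
  l v`_2 v`_1, L0).
have right x y := (r x y v`_1 v`_0, r x y v`_3 v`_2, r x y v`_2 v`_0,
  r x y v`_1 v`_3, r x y v`_3 v`_0, r x y v`_2 v`_1, R0 x y).
have swap := (s v`_2 v`_3 v`_0 v`_1, s v`_0 v`_2 v`_0 v`_1, s v`_3 v`_1 v`_0 v`_1,
  s v`_0 v`_3 v`_0 v`_1, s v`_1 v`_2 v`_0 v`_1,
  s v`_0 v`_2 v`_2 v`_3, s v`_3 v`_1 v`_2 v`_3, s v`_0 v`_3 v`_2 v`_3,
  s v`_1 v`_2 v`_2 v`_3,
  s v`_3 v`_1 v`_0 v`_2, s v`_0 v`_3 v`_0 v`_2, s v`_1 v`_2 v`_0 v`_2,
  s v`_0 v`_3 v`_3 v`_1, s v`_1 v`_2 v`_3 v`_1, s v`_1 v`_2 v`_0 v`_3).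
have ric x y : Rm x v`_0 y v`_0 + Rm x v`_1 y v`_1
    + (Rm x v`_2 y v`_2 + Rm x v`_3 y v`_3) = ricci Rm x y.
  by rewrite (ricci_onb _ _ _ ov) // !big_ord_recl big_ord0 addr0 /= !addrA.
pose dot x y z t := frame_dot v (Rm x y) (Rm z t).
have dotl x y z t : dot x y z t = - dot y x z t.
  by rewrite /dot /frame_dot !(l x y); ring.
have dotr x y z t : dot x y z t = - dot x y t z.
  by rewrite /dot /frame_dot !(l z t); ring.
have dot0l x z t : dot x x z t = 0 by rewrite /dot /frame_dot !L0; ring.
have dot0r x y z : dot x y z z = 0 by rewrite /dot /frame_dot !L0; ring.
have Q x y : dot x v`_0 y v`_0 + dot x v`_1 y v`_1
    + (dot x v`_2 y v`_2 + dot x v`_3 y v`_3) = a / 2 * g x y.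
  by have := curvature_square_frame ov cRm x y; rewrite [LHS]we /dot; lra.
have dotE := (dotl v`_1 v`_0, dotl v`_3 v`_2, dotl v`_2 v`_0, dotl v`_1 v`_3,
  dotl v`_3 v`_0, dotl v`_2 v`_1, fun x y => dotr x y v`_1 v`_0,
  fun x y => dotr x y v`_3 v`_2, fun x y => dotr x y v`_2 v`_0,
  fun x y => dotr x y v`_1 v`_3, fun x y => dotr x y v`_3 v`_0,
  fun x y => dotr x y v`_2 v`_1, dot0l, dot0r).
have [|||||||||||[AA BB DD EE FF] [AC AD AE AF] [BC BD BE BF] [CE CF DE DF]] :=
  @block_equations R lambda (scalar_curvature Rm / 4)
  (Rm v`_0 v`_1 v`_0 v`_1) (Rm v`_0 v`_1 v`_2 v`_3) (Rm v`_0 v`_1 v`_0 v`_2)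
  (Rm v`_0 v`_1 v`_3 v`_1) (Rm v`_0 v`_1 v`_0 v`_3) (Rm v`_0 v`_1 v`_1 v`_2)
  (Rm v`_2 v`_3 v`_2 v`_3) (Rm v`_2 v`_3 v`_0 v`_2) (Rm v`_2 v`_3 v`_3 v`_1)
  (Rm v`_2 v`_3 v`_0 v`_3) (Rm v`_2 v`_3 v`_1 v`_2) (Rm v`_0 v`_2 v`_0 v`_2)
  (Rm v`_0 v`_2 v`_3 v`_1) (Rm v`_0 v`_2 v`_0 v`_3) (Rm v`_0 v`_2 v`_1 v`_2)
  (Rm v`_3 v`_1 v`_3 v`_1) (Rm v`_3 v`_1 v`_0 v`_3) (Rm v`_3 v`_1 v`_1 v`_2)
  (Rm v`_0 v`_3 v`_0 v`_3) (Rm v`_0 v`_3 v`_1 v`_2) (Rm v`_1 v`_2 v`_1 v`_2) l0.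
- have := ric v`_0 v`_0; have := ric v`_1 v`_1.
  by rewrite ric0 ric1 !(frame_gramE ov) /= ?(left, right) => *; split; lra.
- have := ric v`_2 v`_2; have := ric v`_3 v`_3.
  by rewrite ric2 ric3 !(frame_gramE ov) /= ?(left, right) => *; split; lra.
- have := (ric v`_0 v`_1, ric v`_0 v`_2, ric v`_0 v`_3, ric v`_1 v`_2, ric v`_1 v`_3).
  rewrite !ric0 !ric1 !(frame_gramE ov) /= ?(left, right) ?swap => -[[[[? ?] ?] ?] ?].
  by split; lra.
- by have := ric v`_2 v`_3; rewrite ric2 !(frame_gramE ov) /= ?(left, right) ?swap; lra.
- by move: m1; rewrite /mixed /dual2 /dual3 ?swap; lra.
- by move: m2; rewrite /mixed /dual2 /dual3 ?swap; lra.
- have := Q v`_0 v`_0; have := Q v`_2 v`_2.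
  by rewrite !(frame_gramE ov) /= !dotE /dot /frame_dot ?swap; lra.
- by have := Q v`_0 v`_2; rewrite !(frame_gramE ov) /= !dotE /dot /frame_dot ?swap; lra.
- by have := Q v`_0 v`_3; rewrite !(frame_gramE ov) /= !dotE /dot /frame_dot ?swap; lra.
- by have := Q v`_1 v`_2; rewrite !(frame_gramE ov) /= !dotE /dot /frame_dot ?swap; lra.
- by have := Q v`_1 v`_3; rewrite !(frame_gramE ov) /= !dotE /dot /frame_dot ?swap; lra.
exists (Rm v`_0 v`_2 v`_0 v`_2), (Rm v`_0 v`_1 v`_2 v`_3),
  (Rm v`_0 v`_2 v`_3 v`_1), (Rm v`_0 v`_3 v`_1 v`_2).
split; first by have := bi v`_0 v`_1 v`_2 v`_3; rewrite ?(left, right) ?swap; lra.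
have bE x y z t := bivector_expand ov x y (curvature_bivectorl cRm z t).
split=> x y; rewrite !(bE x y) ?swap.
- by rewrite AA BB AC AD AE AF BC BD BE BF; split; ring.
- by rewrite AC AD BC BD DD CE CF DE DF; split; ring.
- by rewrite AE AF BE BF EE FF CE CF DE DF; split; ring.
Qed.

End Core.

(** * Orientation and the classification *)

Section Orientation.
Variables (R : realType) (T : oriented_euclidean4 R).
Implicit Types (v : 4.-tuple T).
Local Notation g := (metric T).

Definition reflect_last v : 4.-tuple T := [tuple v`_0; v`_1; v`_2; - v`_3].

Lemma reflect_last_orthonormal v : orthonormal g v -> orthonormal g (reflect_last v).
Proof.
move=> ov; apply/orthonormal_gram => i j.
case: i => [[|[|[|[|//]]]] i4]; case: j => [[|[|[|[|//]]]] j4] /=;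
  by rewrite ?linearNr ?linearNl /= ?(frame_gramE ov) //= ?oppr0 ?opprK.
Qed.

(** The coordinate determinant of an orthonormal frame is nonzero and changes its
    sign with the last vector. *)
Lemma orthonormal_orientation v : orthonormal g v ->
  positive_onb v \/ positive_onb (reflect_last v).
Proof.
move=> ov; have [o bo oE] := orientation_class T.
have [oe /[!oE] -[_ de]] := onbP T.
pose M (w : 4.-tuple T) := \matrix_(i < 4, j < 4) coord o j w`_i.
have basis (w : 4.-tuple T) : orthonormal g w -> basis_of {:T} w.
  move=> /orthonormal_gram/gram_basis; congr (basis_of _ _).
  by apply: (@eq_from_nth _ 0) => [|i]; rewrite !size_tuple // => i4;
    rewrite (nth_mktuple _ _ (Ordinal i4)).
have ME : M v = transition (onb T) v *m M (onb T).
  apply/matrixP => i j; rewrite !mxE.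
  rewrite {1}(gram_expand v`_i ((orthonormal_gram _).1 oe)) linear_sum.
  by apply: eq_bigr => k _; rewrite linearZ !mxE.
have d0 : \det (M v) != 0.
  rewrite ME det_mulmx mulf_neq0 //; last by rewrite gt_eqF.
  have := congr1 determinant (transition_orth oe ov).
  rewrite det_mulmx det_tr det1 => dd; apply/eqP => d0; move: dd.
  by rewrite d0 mul0r => /esym/eqP; rewrite oner_eq0.
have MrE : \det (M (reflect_last v)) = - \det (M v).
  pose d := \row_(i < 4) (if i == ord_max then -1 else 1 : R).
  rewrite (_ : M _ = diag_mx d *m M v).
    rewrite det_mulmx det_diag !big_ord_recr big_ord0 /= !mxE /=.
    by rewrite !mul1r mulN1r.
  apply/matrixP => i j; rewrite mul_diag_mx !mxE.
  by case: i => [[|[|[|[|//]]]] i4] /=; rewrite ?mul1r // linearN mulN1r.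
have [dv|dv|/esym/eqP] := ltgtP 0 (\det (M v)); last by rewrite (negPf d0).
- by left; split=> //; rewrite oE; split=> //; exact: basis.
- right; have orv := reflect_last_orthonormal ov.
  by split=> //; rewrite oE; split; [exact: basis | rewrite MrE oppr_gt0].
Qed.

Variable Rm : T -> T -> T -> T -> R.
Hypothesis cRm : curvature_tensor Rm.

Lemma reflect_last_eigenframe v lambda :
  eigenframe Rm v lambda -> eigenframe Rm (reflect_last v) lambda.
Proof.
move=> [ov ev]; split; first exact: reflect_last_orthonormal.
move=> [[|[|[|[|//]]]] i4] y /=.
- exact: (ev (@Ordinal 4 0 isT)).
- exact: (ev (@Ordinal 4 1 isT)).
- exact: (ev (@Ordinal 4 2 isT)).
rewrite (scalarN _ (einstein_scalarl cRm y)) (scalarN _ (metric_scalarl y)) mulrN.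
by congr (- _); exact: (ev (@Ordinal 4 3 isT)).
Qed.

(** A reflection exchanges self-dual and anti-self-dual bivectors. *)
Lemma reflect_last_mixed eps v : mixed Rm eps (reflect_last v) = - mixed Rm (- eps) v.
Proof.
have [[l1 _ _ l4] _ _ _ _] := cRm; rewrite /mixed /dual2 /dual3 /=.
rewrite !(scalarN _ (l1 _ _ _)) !(scalarN _ (l4 _ _ _)); ring.
Qed.

Lemma weakly_einstein_data :
  weakly_einstein Rm -> two_distinct_double_eigenvalues (einstein Rm) ->
  exists (u : 4.-tuple T) (s lambda xi c2 c3 c4 : R),
    [/\ positive_onb u, c2 + c3 + c4 = 0, 0 < lambda &
        curvature_data Rm u s lambda xi c2 c3 c4].
Proof.
move=> we /(eigenframe_exists cRm)[v0 [lambda [l0 ev0]]].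
have [v [ev m1 m2]] := unmixed_eigenframe cRm ev0.
have [u [pu eu mu1 mu2]] : exists u, [/\ positive_onb u, eigenframe Rm u lambda,
    mixed Rm 1 u = 0 & mixed Rm (-1) u = 0].
  have [pv|pr] := orthonormal_orientation ev.1; first by exists v.
  exists (reflect_last v); split=> //; first exact: reflect_last_eigenframe.
    by rewrite reflect_last_mixed m2 oppr0.
  by rewrite reflect_last_mixed opprK m1 oppr0.
have [xi [c2 [c3 [c4 [c0 blk]]]]] := eigenframe_blocks cRm eu l0 we mu1 mu2.
exists u, (scalar_curvature Rm), lambda, xi, c2, c3, c4; split=> //.
by apply/curvature_data_blocks => //; split=> //; have [] := eu.
Qed.

End Orientation.

Theorem theorem1p5 (R : realType) (T : oriented_euclidean4 R) :
  (forall (u : 4.-tuple T) (s lambda xi c2 c3 c4 : R)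
          (Rm : T -> T -> T -> T -> R),
     positive_onb u -> c2 + c3 + c4 = 0 -> 0 < lambda ->
     curvature_tensor Rm -> curvature_data Rm u s lambda xi c2 c3 c4 ->
     let W (i j k l : nat) := weyl Rm u`_i u`_j u`_k u`_l in
     (* (a) *)
     weakly_einstein Rm
     (* (b) *)
     /\ [/\ (forall i j k l : 'I_4,
               ~ algebraically_related 0 1 0 1 i j k l ->
               ~ algebraically_related 0 2 0 2 i j k l ->
               ~ algebraically_related 0 3 0 3 i j k l ->
               ~ algebraically_related 2 3 2 3 i j k l ->
               ~ algebraically_related 1 3 1 3 i j k l ->
               ~ algebraically_related 1 2 1 2 i j k l ->
               ~ algebraically_related 0 1 2 3 i j k l ->
               ~ algebraically_related 0 2 3 1 i j k l ->
               ~ algebraically_related 0 3 1 2 i j k l ->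
               W i j k l = 0),
            (W 0%N 1%N 0%N 1%N, W 0%N 2%N 0%N 2%N, W 0%N 3%N 0%N 3%N)
              = (- s / 12, xi - s / 12, - xi + s / 6),
            (W 2%N 3%N 2%N 3%N, W 1%N 3%N 1%N 3%N, W 1%N 2%N 1%N 2%N)
              = (- s / 12, xi - s / 12, - xi + s / 6) &
            (W 0%N 1%N 2%N 3%N, W 0%N 2%N 3%N 1%N, W 0%N 3%N 1%N 2%N) = (c2, c3, c4)])
  (* (c) *)
  /\ (forall Rm : T -> T -> T -> T -> R,
        curvature_tensor Rm -> weakly_einstein Rm ->
        two_distinct_double_eigenvalues (einstein Rm) ->
        exists (u : 4.-tuple T) (s lambda xi c2 c3 c4 : R),
          [/\ positive_onb u, c2 + c3 + c4 = 0, 0 < lambda &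
              curvature_data Rm u s lambda xi c2 c3 c4]).
Proof.
split=> [u s lambda xi c2 c3 c4 Rm pu _ _ cRm data W|Rm cRm]; last first.
  exact: weakly_einstein_data.
have [w1 w2 w3] := curvature_data_weyl_components pu cRm data.
split; first exact: curvature_data_weakly_einstein pu cRm data.
split=> // i j k l n1 n2 n3 n4 n5 n6 n7 n8 n9.
apply: (curvature_data_weyl_vanish pu cRm data) => c.
by rewrite !inE; do 8!(case/orP; first by move/eqP->); move/eqP->.
Qed.
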